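(* Let $G$ be a group acting isometrically and discretely on a separable CAT(0)-space $X$ of topological dimension $n$, and let $\mathcal{F}$ be the smallest family of subgroups of $G$ containing the point stabilizers $G_x$, for every $x\in X$. Then \[\mathrm{cd}_{\mathcal{F}}(G)\leq n.\]
   Context: All groups are discrete. $G_x$ denotes the stabilizer of $x\in X$. $G$ acts discretely on $X$ if every orbit $G\cdot x$ is a discrete subset of $X$ (discrete in the subspace topology). Topological dimension is covering dimension: the infimum of the integers $d\ge 0$ such that every open cover of $X$ has an open refinement in which any $d+2$ pairwise distinct members have empty intersection. A family $\mathcal{F}$ of subgroups of $G$ is a collection of subgroups closed under conjugation and under taking subgroups. The orbit category $\mathcal{O}_{\mathcal{F}}G$ has as objects the left coset spaces $G/H$, $H\in\mathcal{F}$, and as morphisms all $G$-equivariant maps. An $\mathcal{O}_{\mathcal{F}}G$-module is a contravariant functor from $\mathcal{O}_{\mathcal{F}}G$ to abelian groups; these form an abelian category with enough projectives (exactness is objectwise). $\underline{\mathbb{Z}}$ is the constant functor with value $\mathbb{Z}$ sending all morphisms to the identity, $\mathrm{H}^n_{\mathcal{F}}(G,M)=\mathrm{Ext}^n_{\mathcal{O}_{\mathcal{F}}G}(\underline{\mathbb{Z}},M)$, and $\mathrm{cd}_{\mathcal{F}}(G)=\sup\{n\in\mathbb{N} : \mathrm{H}^n_{\mathcal{F}}(G,M)\neq 0 \text{ for some } \mathcal{O}_{\mathcal{F}}G\text{-module } M\}$. *)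

(* Defs.v *)
From HB Require Import structures.
From mathcomp Require Import all_boot all_order all_algebra.
From mathcomp Require Import generic_quotient ring_quotient.
From mathcomp Require Import freeg.
From mathcomp Require Import all_classical all_reals all_analysis.

Set Implicit Arguments.
Unset Strict Implicit.
Unset Printing Implicit Defensive.

Import Order.TTheory GRing.Theory Num.Theory.

Local Open Scope classical_set_scope.
Local Open Scope ring_scope.

Definition separable_space (T : topologicalType) : Prop :=
  exists2 D : set T, countable D & dense D.

Section CAT0.
Context {R : realType}.

(** The norm that the library puts on ['rV[R]_2] is the sup norm, whence an
    explicit Euclidean distance. *)
Definition edist (p q : 'rV[R]_2) : R :=
  Num.sqrt (\sum_i (p ord0 i - q ord0 i) ^+ 2).

Variable X : metricType R.

Definition geodesic (x y : X) (c : R -> X) : Prop :=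
  [/\ c 0 = x, c (mdist x y) = y &
      {in `[0, mdist x y] &, forall s t, mdist (c s) (c t) = `|s - t|}].

Definition geodesic_space : Prop := forall x y, exists c, geodesic x y c.

(** [P] is the comparison point, on the Euclidean segment from [p] to [q], of
    the point [y] of a geodesic segment issued from [x]. *)
Definition comparison_point (p q P : 'rV[R]_2) (x y : X) : Prop :=
  (exists2 s, s \in `[0, 1] & P = (1 - s) *: p + s *: q) /\
  edist p P = mdist x y.

(** The [i]-th side of a triangle joins the vertices [v i] and [v (ordS i)],
    where [ordS] is the cyclic successor of ['I_3]. *)
Definition CAT0 : Prop :=
  geodesic_space /\
  forall (v : 'I_3 -> X) (c : 'I_3 -> R -> X) (p : 'I_3 -> 'rV[R]_2),
    (forall i, geodesic (v i) (v (ordS i)) (c i)) ->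
    (forall i j, edist (p i) (p j) = mdist (v i) (v j)) ->
  forall (i j : 'I_3) (s t : R) (P Q : 'rV[R]_2),
    s \in `[0, mdist (v i) (v (ordS i))] ->
    t \in `[0, mdist (v j) (v (ordS j))] ->
    comparison_point (p i) (p (ordS i)) P (v i) (c i s) ->
    comparison_point (p j) (p (ordS j)) Q (v j) (c j t) ->
    mdist (c i s) (c j t) <= edist P Q.

End CAT0.

Definition open_covering (T : topologicalType) (U : set (set T)) : Prop :=
  U `<=` open /\ \bigcup_(A in U) A = setT.

Definition refines (T : Type) (V U : set (set T)) : Prop :=
  forall B, V B -> exists2 A, U A & B `<=` A.

Definition has_covering_bound (T : topologicalType) (d : nat) : Prop :=
  forall U : set (set T), open_covering U ->
  exists V : set (set T), [/\ open_covering V, refines V U &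
    forall B : 'I_d.+2 -> set T, injective B -> (forall i, V (B i)) ->
      \bigcap_i B i = set0].

(** [+oo] if there is no bound. *)
Definition covering_dimension (R : realType) (T : topologicalType) : \bar R :=
  ereal_inf [set (d%:R)%:E | d in has_covering_bound T].

Section Actions.
Local Open Scope group_scope.
Variable G : groupType.

Definition action_law (T : Type) (act : G -> T -> T) : Prop :=
  (forall x, act 1 x = x) /\ (forall g h x, act (g * h) x = act g (act h x)).

Definition isometric_action (R : realType) (X : metricType R)
  (act : G -> X -> X) : Prop := forall g x y, mdist (act g x) (act g y) = mdist x y.

Definition action_orbit (T : Type) (act : G -> T -> T) (x : T) : set T :=
  range (act^~ x).

Definition discrete_action (T : topologicalType) (act : G -> T -> T) : Prop :=
  forall x, action_orbit act x `<=` isolated (action_orbit act x).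

Definition stabilizer (T : Type) (act : G -> T -> T) (x : T) : set G :=
  [set g | act g x = x].

Definition is_subgroup (H : set G) : Prop :=
  [/\ H 1, forall x y, H x -> H y -> H (x * y) & forall x, H x -> H x^-1].

Definition is_family (F : set (set G)) : Prop :=
  [/\ F `<=` is_subgroup,
      forall H g, F H -> F [set g * h * g^-1 | h in H] &
      forall H K, F H -> is_subgroup K -> K `<=` H -> F K].

End Actions.

Section OrbitCategory.
Local Open Scope group_scope.
Variable G : groupType.

Definition left_coset (g : G) (H : set G) : set G := [set g * h | h in H].

Lemma left_cosetM (g h : G) (H : set G) : left_coset g (left_coset h H) = left_coset (g * h) H.
Proof.
apply/seteqP; split => [_ [_ [x Hx <-] <-]|_ [x Hx <-]].
  by exists x; rewrite ?mulgA.
by exists (h * x); [exists x|rewrite mulgA].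
Qed.

(** The left cosets of [H], as subsets of [G]. *)
Definition coset_space (H : set G) := {C : set G | exists g, C = left_coset g H}.

Lemma coset_act_subproof (H : set G) (g : G) (C : coset_space H) :
  exists h, left_coset g (sval C) = left_coset h H.
Proof. by case: C => /= C [h ->]; exists (g * h); rewrite left_cosetM. Qed.

Definition coset_act (H : set G) (g : G) (C : coset_space H) : coset_space H :=
  exist _ (left_coset g (sval C)) (coset_act_subproof g C).

Record gmap (H K : set G) := GMap {
  gmap_fun :> coset_space H -> coset_space K;
  gmapP : forall g C, gmap_fun (coset_act g C) = coset_act g (gmap_fun C) }.

Lemma gmap_eq (H K : set G) (u v : gmap H K) : u =1 v -> u = v.
Proof.
case: u v => [u uP] [v vP] /= /funext uv; case: _ / uv in vP *.
by rewrite (Prop_irrelevance uP vP).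
Qed.

Definition gmap_id (H : set G) : gmap H H := @GMap H H id (fun _ _ => erefl).

Lemma gmap_comp_subproof (H K L : set G) (v : gmap K L) (u : gmap H K) g C :
  v (u (coset_act g C)) = coset_act g (v (u C)).
Proof. by rewrite !gmapP. Qed.

Definition gmap_comp (H K L : set G) (v : gmap K L) (u : gmap H K) : gmap H L :=
  GMap (gmap_comp_subproof v u).

Variable F : set (set G).

(** The subgroup [H] stands for the object G/H; a morphism from G/H to G/K is a
    term of [gmap H K]. *)
Definition orbit_obj := {H : set G | F H}.
Definition orbit_hom (a b : orbit_obj) := gmap (sval a) (sval b).

End OrbitCategory.

Section Modules.
Variables (G : groupType) (F : set (set G)).
Local Notation obj := (orbit_obj F).

Record orbit_module := OrbitModule {
  om_obj :> obj -> zmodType;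
  om_map : forall a b : obj, orbit_hom a b -> {additive om_obj b -> om_obj a};
  om_id : forall a x, om_map (gmap_id (sval a) : orbit_hom a a) x = x;
  om_comp : forall (a b c : obj) (u : orbit_hom a b) (v : orbit_hom b c) x,
    om_map (gmap_comp v u : orbit_hom a c) x = om_map u (om_map v x) }.

Record om_hom (M N : orbit_module) := OmHom {
  oh_fun :> forall a, {additive M a -> N a};
  oh_nat : forall (a b : obj) (u : orbit_hom a b) x,
    oh_fun a (om_map M u x) = om_map N u (oh_fun b x) }.

Lemma om_hom_eq (M N : orbit_module) (f g : om_hom M N) :
  (forall a x, f a x = g a x) -> f = g.
Proof.
case: f g => [f fP] [g gP] /= fg.
have {}fg : f = g.
  apply: functional_extensionality_dep => a.
  move: (f a) (g a) (fg a) => [/= h [[hP]]] [/= k [[kP]]] /funext hk.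
  by case: _ / hk in kP *; rewrite (Prop_irrelevance hP kP).
by case: _ / fg in gP *; rewrite (Prop_irrelevance fP gP).
Qed.

Lemma om_comp_hom_subproof (M N L : orbit_module)
  (g : om_hom N L) (f : om_hom M N) (a b : obj) (u : orbit_hom a b) x :
  (g a \o f a) (om_map M u x) = om_map L u ((g b \o f b) x).
Proof. by rewrite /= !oh_nat. Qed.

Definition om_hom_comp (M N L : orbit_module)
  (g : om_hom N L) (f : om_hom M N) : om_hom M L :=
  @OmHom M L (fun a => g a \o f a) (om_comp_hom_subproof g f).

Definition constZ : orbit_module :=
  @OrbitModule (fun=> int) (fun _ _ _ => idfun) (fun _ _ => erefl)
    (fun _ _ _ _ _ _ => erefl).

Section HomGroup.
Variables M N : orbit_module.

HB.instance Definition _ := gen_eqMixin (om_hom M N).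
HB.instance Definition _ := gen_choiceMixin (om_hom M N).

Definition om_zero : om_hom M N.
Proof. by exists (fun a => \0) => a b u x; rewrite /= raddf0. Defined.
Definition om_opp (f : om_hom M N) : om_hom M N.
Proof. by exists (fun a => \- f a) => a b u x; rewrite /= raddfN oh_nat. Defined.
Definition om_add (f g : om_hom M N) : om_hom M N.
Proof. by exists (fun a => f a \+ g a) => a b u x; rewrite /= raddfD !oh_nat. Defined.

Lemma om_addA : associative om_add.
Proof. by move=> f g h; apply: om_hom_eq => a x /=; rewrite addrA. Qed.
Lemma om_addC : commutative om_add.
Proof. by move=> f g; apply: om_hom_eq => a x /=; rewrite addrC. Qed.
Lemma om_add0 : left_id om_zero om_add.
Proof. by move=> f; apply: om_hom_eq => a x /=; rewrite add0r. Qed.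
Lemma om_addN : left_inverse om_zero om_opp om_add.
Proof. by move=> f; apply: om_hom_eq => a x /=; rewrite addNr. Qed.

HB.instance Definition _ :=
  GRing.isZmodule.Build (om_hom M N) om_addA om_addC om_add0 om_addN.

End HomGroup.

Definition om_pre (M N B : orbit_module) (d : om_hom M N) (f : om_hom N B) :
  om_hom M B := om_hom_comp f d.

Lemma om_pre_is_additive (M N B : orbit_module) (d : om_hom M N) :
  zmod_morphism (@om_pre M N B d).
Proof. by move=> f g; apply: om_hom_eq. Qed.

HB.instance Definition _ (M N B : orbit_module) (d : om_hom M N) :=
  GRing.isZmodMorphism.Build (om_hom N B) (om_hom M B) (@om_pre M N B d)
    (om_pre_is_additive d).

Definition epi (M N : orbit_module) (f : om_hom M N) : Prop :=
  forall a y, exists x, f a x = y.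

Definition exact_at (M N L : orbit_module) (f : om_hom M N) (g : om_hom N L) :
  Prop := forall a y, g a y = 0 <-> exists x, f a x = y.

Definition projective (P : orbit_module) : Prop :=
  forall (M N : orbit_module) (e : om_hom M N) (g : om_hom P N),
    epi e -> exists h : om_hom P M, om_hom_comp e h = g.

Record projective_resolution (A : orbit_module) := ProjectiveResolution {
  pr_obj :> nat -> orbit_module;
  pr_diff : forall k, om_hom (pr_obj k.+1) (pr_obj k);
  pr_aug : om_hom (pr_obj 0%N) A;
  pr_projective : forall k, projective (pr_obj k);
  pr_epi : epi pr_aug;
  pr_exact0 : exact_at (pr_diff 0%N) pr_aug;
  pr_exact : forall k, exact_at (pr_diff k.+1) (pr_diff k) }.

End Modules.

Section FreeAbelianGroup.
Variables (K : choiceType) (V : zmodType).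

Definition zlift (f : K -> V) : {freeg K / int} -> V :=
  fglift (f : K -> zmodule V).

Lemma zlift_is_additive (f : K -> V) : zmod_morphism (zlift f).
Proof. exact: (@lift_is_additive _ _ (zmodule V)). Qed.

HB.instance Definition _ (f : K -> V) :=
  GRing.isZmodMorphism.Build {freeg K / int} V (zlift f) (zlift_is_additive f).

Lemma zliftU (f : K -> V) (k : K) : zlift f << k >> = f k.
Proof. exact: (@liftU _ (zmodule V)). Qed.

Lemma freeg_additive_eq (f g : {additive {freeg K / int} -> V}) :
  (forall k, f << k >> = g << k >>) -> f =1 g.
Proof.
move=> fg D; rewrite -(freeg_sumE D) !raddf_sum; apply: eq_bigr => k _.
have -> : << coeff k D *g k >> = << k >> *~ coeff k D :> {freeg K / int}.
  by rewrite freegU_mulz intz.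
by rewrite !raddfMz fg.
Qed.

End FreeAbelianGroup.

Section FreeModules.
Variables (G : groupType) (F : set (set G)).
Local Notation obj := (orbit_obj F).
Local Notation module := (orbit_module F).

(** The direct sum, over [i : S], of the modules Z[Hom(-, t i)]. *)
Section Free.
Variables (S : Type) (t : S -> obj).

Definition free_basis (a : obj) : choiceType :=
  {classic {i : S & orbit_hom a (t i)}}.
Definition free_elt (a : obj) (i : S) (u : orbit_hom a (t i)) : free_basis a :=
  existT _ i u.
Definition free_obj (a : obj) : zmodType := {freeg (free_basis a) / int}.

Definition free_map (a b : obj) (u : orbit_hom a b) :
    {additive free_obj b -> free_obj a} :=
  zlift (fun k : free_basis b =>
    << free_elt (gmap_comp (projT2 k) u : orbit_hom a (t (projT1 k))) >>).

Lemma free_mapU (a b : obj) (u : orbit_hom a b) i (v : orbit_hom b (t i)) :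
  free_map u << free_elt v >> = << free_elt (gmap_comp v u : orbit_hom a _) >>.
Proof. exact: zliftU. Qed.

Lemma free_map_id a x : free_map (gmap_id (sval a) : orbit_hom a a) x = x.
Proof.
apply: (@freeg_additive_eq _ _ (free_map _) idfun) => -[i v].
by rewrite [LHS]free_mapU; congr << free_elt _ >>; apply: gmap_eq.
Qed.

Lemma free_map_comp (a b c : obj) (u : orbit_hom a b) (v : orbit_hom b c) x :
  free_map (gmap_comp v u : orbit_hom a c) x = free_map u (free_map v x).
Proof.
apply: (@freeg_additive_eq _ _ (free_map _) (free_map u \o free_map v)).
move=> [i w]; rewrite [RHS]/= !free_mapU.
by congr << free_elt _ >>; apply: gmap_eq.
Qed.

Definition free_module : module := OrbitModule free_map_id free_map_comp.

Section Lift.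
Variables (M : module) (m : forall i, M (t i)).

Definition free_lift_fun (a : obj) : {additive free_module a -> M a} :=
  zlift (fun k : free_basis a => om_map M (projT2 k) (m (projT1 k))).

Lemma free_liftU (a : obj) i (v : orbit_hom a (t i)) :
  free_lift_fun a << free_elt v >> = om_map M v (m i).
Proof. exact: zliftU. Qed.

Lemma free_lift_nat (a b : obj) (u : orbit_hom a b) x :
  free_lift_fun a (om_map free_module u x) = om_map M u (free_lift_fun b x).
Proof.
apply: (@freeg_additive_eq _ _ (free_lift_fun a \o free_map u)
  (om_map M u \o free_lift_fun b)) => -[i w].
by rewrite /= free_mapU !free_liftU om_comp.
Qed.

Definition free_lift : om_hom free_module M := OmHom free_lift_nat.

End Lift.

Lemma free_module_projective : projective free_module.
Proof.
move=> M N e g e_epi.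
pose gen i : free_module (t i) :=
  << free_elt (gmap_id (sval (t i)) : orbit_hom (t i) (t i)) >>.
pose m i : M (t i) := sval (cid (e_epi (t i) (g (t i) (gen i)))).
have mE i : e (t i) (m i) = g (t i) (gen i) by rewrite /m; case: cid.
exists (free_lift m); apply: om_hom_eq => a.
apply: (@freeg_additive_eq _ _ (e a \o free_lift m a) (g a)) => -[i v].
rewrite /= free_liftU oh_nat mE -oh_nat; congr (g a _).
by rewrite [LHS]free_mapU; congr << free_elt _ >>; apply: gmap_eq.
Qed.

End Free.

(** The canonical epimorphism onto [M] from a free module, with one generator
    over [a] for each element of [M a]. *)
Definition free_cover_index (M : module) := {a : obj & M a}.
Definition free_cover (M : module) : module :=
  free_module (fun i : free_cover_index M => projT1 i).
Definition free_cover_map (M : module) : om_hom (free_cover M) M :=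
  free_lift (fun i : free_cover_index M => projT2 i).

Lemma free_cover_epi (M : module) : epi (free_cover_map M).
Proof.
move=> a x; exists << free_elt (t := fun i : free_cover_index M => projT1 i)
  (i := existT _ a x) (gmap_id (sval a) : orbit_hom a a) >>.
by rewrite free_liftU om_id.
Qed.

End FreeModules.

Section Kernel.
Variables (A B : zmodType) (g : {additive A -> B}).

Definition ker_pred : {pred A} := fun x => g x == 0.

Lemma ker_zmod_closed : zmod_closed ker_pred.
Proof.
split=> [|x y]; rewrite !unfold_in ?raddf0 // => /eqP gx /eqP gy.
by rewrite raddfB gx gy subr0.
Qed.

HB.instance Definition _ := GRing.isZmodClosed.Build A ker_pred ker_zmod_closed.

Definition ker : Type := {x : A | x \in ker_pred}.

HB.instance Definition _ := SubChoice.on ker.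
HB.instance Definition _ := [SubChoice_isSubZmodule of ker by <:].

Lemma kerP (x : ker) : g (val x) = 0.
Proof. by case: x => x /= /eqP. Qed.

End Kernel.

Section KernelModule.
Variables (G : groupType) (F : set (set G)).
Local Notation obj := (orbit_obj F).
Local Notation module := (orbit_module F).
Variables (M N : module) (f : om_hom M N).

Lemma ker_map_subproof (a b : obj) (u : orbit_hom a b) (x : ker (f b)) :
  om_map M u (val x) \in ker_pred (f a).
Proof. by rewrite unfold_in oh_nat kerP raddf0. Qed.

Definition ker_map (a b : obj) (u : orbit_hom a b) (x : ker (f b)) : ker (f a) :=
  Sub (om_map M u (val x)) (ker_map_subproof u x).

Lemma ker_map_is_additive (a b : obj) (u : orbit_hom a b) :
  zmod_morphism (ker_map u).
Proof. by move=> x y; apply: val_inj; rewrite /= !raddfB. Qed.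

HB.instance Definition _ (a b : obj) (u : orbit_hom a b) :=
  GRing.isZmodMorphism.Build (ker (f b)) (ker (f a)) (ker_map u)
    (ker_map_is_additive u).

Lemma ker_map_id a x : ker_map (gmap_id (sval a) : orbit_hom a a) x = x.
Proof. by apply: val_inj; rewrite /= om_id. Qed.

Lemma ker_map_comp (a b c : obj) (u : orbit_hom a b) (v : orbit_hom b c) x :
  ker_map (gmap_comp v u : orbit_hom a c) x = ker_map u (ker_map v x).
Proof. by apply: val_inj; rewrite /= om_comp. Qed.

Definition ker_module : module :=
  @OrbitModule _ F (fun a => ker (f a)) (fun a b u => ker_map u)
    ker_map_id ker_map_comp.

Definition ker_incl : om_hom ker_module M :=
  @OmHom _ _ ker_module M (fun a => val : {additive ker (f a) -> M a})
    (fun _ _ _ _ => erefl).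

End KernelModule.

Section FreeResolution.
Variables (G : groupType) (F : set (set G)) (A : orbit_module F).

Fixpoint syzygy (k : nat) : orbit_module F :=
  if k is k'.+1 then ker_module (free_cover_map (syzygy k')) else A.

Definition free_res_obj (k : nat) := free_cover (syzygy k).

Definition free_res_diff (k : nat) : om_hom (free_res_obj k.+1) (free_res_obj k) :=
  om_hom_comp (ker_incl (free_cover_map (syzygy k))) (free_cover_map (syzygy k.+1)).

Lemma free_res_diffP k a y :
  free_cover_map (syzygy k) a y = 0 <-> exists x, free_res_diff k a x = y.
Proof.
split=> [y0|[x <-]]; last exact: kerP.
have yP : y \in ker_pred (free_cover_map (syzygy k) a) by apply/eqP.
have [x xE] := free_cover_epi (Sub y yP : syzygy k.+1 a).
by exists x; rewrite /= xE.
Qed.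

Lemma free_res_exact k : exact_at (free_res_diff k.+1) (free_res_diff k).
Proof.
move=> a y; rewrite -free_res_diffP; split=> [y0|/= -> //].
exact: val_inj.
Qed.

Definition free_resolution : projective_resolution A :=
  @ProjectiveResolution _ _ A free_res_obj free_res_diff
    (free_cover_map A) (fun k => @free_module_projective _ _ _ _)
    (@free_cover_epi _ _ A) (@free_res_diffP 0%N) free_res_exact.

End FreeResolution.

Section Homology.
Variables (A B C : zmodType) (f : {additive A -> B}) (g : {additive B -> C}).

Definition im_pred : {pred ker g} := fun x => `[< exists a, f a = val x >].

Lemma im_zmod_closed : zmod_closed im_pred.
Proof.
split=> [|x y]; rewrite !unfold_in.
  by apply/asboolP; exists 0; rewrite raddf0.
move=> /asboolP[a ax] /asboolP[b bx]; apply/asboolP; exists (a - b).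
by rewrite !raddfB ax bx.
Qed.

HB.instance Definition _ := GRing.isZmodClosed.Build (ker g) im_pred im_zmod_closed.

(** ker g / im f, for composable maps with [g \o f = 0]. *)
Definition homology : zmodType := Quotient.quot im_pred.

End Homology.

Section Ext.
Variables (G : groupType) (F : set (set G)).

Definition cochain_diff (A : orbit_module F) (P : projective_resolution A)
    (B : orbit_module F) (k : nat) :
    {additive om_hom (P k) B -> om_hom (P k.+1) B} :=
  om_pre (pr_diff P k).

(** Ext is computed from the canonical resolution by free modules obtained by
    iterating [free_cover]; in degree 0 the incoming differential is 0. *)
Definition Ext (k : nat) (A B : orbit_module F) : zmodType :=
  let delta := cochain_diff (free_resolution A) B in
  if k is j.+1 then homology (delta j) (delta j.+1)
  else homology (\0 : {additive om_hom (free_resolution A 0%N) B -> _}) (delta 0%N).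

Definition bredon_cohomology (k : nat) (M : orbit_module F) : zmodType :=
  Ext k (constZ F) M.

(** Valued in [\bar R], with [cd F R = -oo] if the cohomology vanishes in all
    degrees, as when [F] is empty. *)
Definition cd (R : realType) : \bar R :=
  ereal_sup [set (k%:R)%:E | k in
    [set k | exists M : orbit_module F, exists h : bredon_cohomology k M, h != 0]].

End Ext.

(* Main.v *)
From HB Require Import structures.
Require Import Defs.
From mathcomp Require Import all_boot all_order all_algebra.
From mathcomp Require Import generic_quotient ring_quotient.
From mathcomp Require Import freeg.
From mathcomp Require Import ring lra.
From mathcomp Require Import all_classical all_reals all_analysis.

Set Implicit Arguments.
Unset Strict Implicit.
Unset Printing Implicit Defensive.

Import Order.TTheory GRing.Theory Num.Theory.
Import numFieldNormedType.Exports.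

Local Open Scope classical_set_scope.
Local Open Scope ring_scope.

(** The theorem bounds the projective dimension of the constant module Z over the
    orbit category. Let P be the canonical free resolution of Z, with Z itself placed in
    degree 0 and the other degrees raised by one. A cocycle on P in degree > n + 1 is
    a coboundary as soon as the identity of P is homotopic to a map that vanishes
    there ([cocycle_is_coboundary]), and such a map is found as a composite
    P -> Q -> C -> P of augmented complexes, where C consists of projective modules
    in positive degrees and is zero in degrees > n + 1. Both Q and C are spanned by
    tuples; a tuple of size k has degree k, and the empty tuple carries the
    augmentation.

    C is the complex of oriented simplices of the nerve of an invariant open cover
    of X such that each point lies in at most n + 1 members. Each member is a
    disjoint union of slices around the points of one discrete orbit, and the
    vertices of the nerve are the slices. A group element that moves a slice to one
    that meets it fixes its centre. Hence the stabilizers of simplices lie in the family,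
    and a module of chains on the fixed points of such a permutation action is
    projective ([perm_module_projective]). Since the slices of one member are
    disjoint, the index of the member orders the vertices of each simplex, and
    the orientations are respected by the group. The map C -> P exists because C
    is projective and P exact.

    Q is spanned by the tuples of points of X contained in a small ball, where the
    admissible radius at a point is a fixed fraction of the largest ball that one
    slice contains. A point is sent to a slice that contains a large part of this
    ball, and the vertices of a small tuple go to slices with a common point; this
    gives Q -> C after antisymmetrization ([alt]). The map P -> Q exists because Q is
    exact on the fixed points of every member H of the family. These are a
    nonempty convex set, and exactness is where the curvature enters
    ([small_acyclic]). A cycle bounds a cone over a fixed point. The cone is not
    small, but it can be subdivided along geodesics; the contraction towards a
    point of a CAT(0) space does not increase distances, so that the mesh of the
    subdivision tends to 0, while its vertices stay in one compact set.

    It remains to find the cover ([slice_cover]). The dimension of X gives small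
    refinements of covers of X, but an invariant cover is one of the orbit space.
    As the orbits are discrete and X is separable, X is a countable union of closed
    sets E whose projections to the orbit space are closed embeddings
    ([countable_sections]). Over such an E a refinement on X can be transported to
    the orbit space ([section_refinement]), and the proof of the countable sum
    theorem of dimension theory assembles these ([order_refinement]). *)

(** * Complexes of orbit modules *)

Section Complexes.
Variables (G : groupType) (F : set (set G)).
Local Notation module := (orbit_module F).

(** By exactness [d] corestricts to an epimorphism onto the kernel of [d']. *)
Lemma projective_lift (P N' N L : module) (d : om_hom N' N) (d' : om_hom N L)
    (f : om_hom P N) :
  projective P -> exact_at d d' -> om_hom_comp d' f = 0 ->
  exists h : om_hom P N', om_hom_comp d h = f.
Proof.
move=> Pproj dd' f0.
have dN a x : d a x \in ker_pred (d' a).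
  by apply/eqP/dd'; exists x.
have fN a x : f a x \in ker_pred (d' a).
  by rewrite unfold_in; have /(congr1 (fun u : om_hom _ _ => u a x)) /= -> := f0.
pose corestr (M : module) (u : om_hom M N)
    (uN : forall a x, u a x \in ker_pred (d' a)) a (x : M a) : ker_module d' a :=
  Sub (u a x) (uN a x).
have cA (M : module) (u : om_hom M N) uN a : zmod_morphism (@corestr M u uN a).
  by move=> x y; apply: val_inj; rewrite /= raddfB.
pose cadd (M : module) (u : om_hom M N) uN a : {additive M a -> ker_module d' a} :=
  HB.pack (@corestr M u uN a) (GRing.isZmodMorphism.Build _ _ _ (cA M u uN a)).
have cnat (M : module) (u : om_hom M N) uN (a b : orbit_obj F)
    (v : orbit_hom a b) x :
    cadd M u uN a (om_map M v x) = om_map (ker_module d') v (cadd M u uN b x).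
  by apply: val_inj; rewrite /= oh_nat.
pose cor M u uN := OmHom (cnat M u uN).
have epid : epi (cor _ d dN).
  move=> a y; have /dd'[x xE] := kerP y.
  by exists x; apply: val_inj.
have [h hE] := Pproj _ _ _ (cor _ f fN) epid.
exists h; apply: om_hom_eq => a x.
by have /(congr1 (fun u : om_hom P (ker_module d') => val (u a x : ker (d' a)))) := hE.
Qed.

(** Complexes are augmented: degree 0 holds the module that is resolved, degree
    [k + 1] the [k]-th term of the resolution. *)
Record complex := Complex {
  cx_obj :> nat -> module;
  cx_diff : forall k, om_hom (cx_obj k.+1) (cx_obj k);
  cx_dd : forall k a x, cx_diff k a (cx_diff k.+1 a x) = 0 }.

Definition acyclic (E : complex) : Prop :=
  epi (cx_diff E 0) /\ forall k, exact_at (cx_diff E k.+1) (cx_diff E k).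

Definition chain_map (E E' : complex) (f : forall k, om_hom (E k) (E' k)) : Prop :=
  forall k a x, f k a (cx_diff E k a x) = cx_diff E' k a (f k.+1 a x).

(** The map in degree 0 is given. In degree [k + 1], following the differential by
    the map in degree [k] yields cycles of [E'], and these are boundaries. *)
Lemma chain_map_exists (E E' : complex) (f0 : om_hom (E 0) (E' 0)) :
  (forall k, projective (E k.+1)) -> acyclic E' ->
  exists f : forall k, om_hom (E k) (E' k), f 0 = f0 /\ chain_map f.
Proof.
move=> Eproj [E'epi E'ex].
pose square k := {p : om_hom (E k) (E' k) * om_hom (E k.+1) (E' k.+1) |
  om_hom_comp (cx_diff E' k) p.2 = om_hom_comp p.1 (cx_diff E k)}.
have [f1 f1E] := Eproj 0 _ _ (cx_diff E' 0) (om_hom_comp f0 (cx_diff E 0)) E'epi.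
have next k (p : square k) : exists f : om_hom (E k.+2) (E' k.+2),
    om_hom_comp (cx_diff E' k.+1) f = om_hom_comp (sval p).2 (cx_diff E k.+1).
  apply: projective_lift (Eproj _) (E'ex k) _; apply: om_hom_eq => a x /=.
  have := svalP p.
  move/(congr1 (fun u : om_hom _ _ => u a (cx_diff E k.+1 a x))) => /= ->.
  by rewrite cx_dd raddf0.
pose step k (p : square k) : square k.+1 :=
  exist _ ((sval p).2, sval (cid (next k p))) (svalP (cid (next k p))).
pose sq := fix sq k : square k :=
  if k is k'.+1 then step k' (sq k') else exist _ (f0, f1) f1E.
exists (fun k => (sval (sq k)).1); split=> // k a x.
by have /(congr1 (fun u : om_hom _ _ => u a x)) /= := svalP (sq k).
Qed.

(** As the map is zero in degree 0, the homotopy can start with zero. *)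
Lemma null_homotopy_exists (E E' : complex) (u : forall k, om_hom (E k) (E' k)) :
  (forall k, projective (E k.+1)) -> acyclic E' -> chain_map u -> u 0 = 0 ->
  exists h : forall k, om_hom (E k) (E' k.+1), forall k a x,
    u k.+1 a x = cx_diff E' k.+1 a (h k.+1 a x) + h k a (cx_diff E k a x).
Proof.
move=> Eproj [_ E'ex] umap u0.
pose square k := {p : om_hom (E k) (E' k.+1) * om_hom (E k.+1) (E' k.+2) |
  om_hom_comp (cx_diff E' k.+1) p.2 = u k.+1 - om_hom_comp p.1 (cx_diff E k)}.
have [h1 h1E] : exists h1 : om_hom (E 1) (E' 2),
    om_hom_comp (cx_diff E' 1) h1 = u 1 - om_hom_comp 0 (cx_diff E 0).
  apply: projective_lift (Eproj _) (E'ex 0) _; apply: om_hom_eq => a x /=.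
  by rewrite raddfB /= raddf0 subr0 -umap u0.
have next k (p : square k) : exists h : om_hom (E k.+2) (E' k.+3),
    om_hom_comp (cx_diff E' k.+2) h
      = u k.+2 - om_hom_comp (sval p).2 (cx_diff E k.+1).
  apply: projective_lift (Eproj _) (E'ex k.+1) _; apply: om_hom_eq => a x /=.
  have := svalP p.
  move/(congr1 (fun v : om_hom _ _ => v a (cx_diff E k.+1 a x))) => /=.
  rewrite raddfB /= => ->.
  by rewrite cx_dd raddf0 subr0 umap subrr.
pose step k (p : square k) : square k.+1 :=
  exist _ ((sval p).2, sval (cid (next k p))) (svalP (cid (next k p))).
pose sq := fix sq k : square k :=
  if k is k'.+1 then step k' (sq k') else exist _ (0, h1) h1E.
exists (fun k => (sval (sq k)).1) => k a x.
have /(congr1 (fun v : om_hom _ _ => v a x)) /= -> := svalP (sq k).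
by rewrite subrK.
Qed.

(** The composite [P -> Q -> C -> P] is the identity in degree 0, hence homotopic to
    the identity. It vanishes where [C] does, and there the homotopy [s] makes any
    cocycle [x] the coboundary of [x \o s]. *)
Lemma cocycle_is_coboundary (P Q C : complex) (n : nat)
    (i : om_hom (P 0) (Q 0)) (phi : forall k, om_hom (Q k) (C k))
    (p : om_hom (C 0) (P 0)) :
  (forall k, projective (P k.+1)) -> acyclic P -> acyclic Q ->
  (forall k, projective (C k.+1)) ->
  (forall k, (n < k)%N -> forall a (x : C k.+1 a), x = 0) ->
  chain_map phi -> (forall a x, p a (phi 0 a (i a x)) = x) ->
  forall k M (x : om_hom (P k.+2) M), (n < k.+1)%N ->
  om_hom_comp x (cx_diff P k.+2) = 0 ->
  exists y : om_hom (P k.+1) M, om_hom_comp y (cx_diff P k.+1) = x.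
Proof.
move=> Pproj Pac Qac Cproj C0 phiP piP k M x nk dx.
have [f [f0 fP]] := chain_map_exists i Pproj Qac.
have [g [g0 gP]] := chain_map_exists p Cproj Pac.
pose th j : om_hom (P j) (P j) := om_hom_comp (g j) (om_hom_comp (phi j) (f j)).
pose idP j : om_hom (P j) (P j) :=
  @OmHom _ _ (P j) (P j) (fun=> idfun) (fun _ _ _ _ => erefl).
have umap : chain_map (fun j => idP j - th j).
  by move=> j a y /=; rewrite fP phiP gP raddfB.
have u0 : idP 0 - th 0 = 0.
  by apply: om_hom_eq => a y /=; rewrite f0 g0 piP subrr.
have [s sE] := null_homotopy_exists Pproj Pac umap u0.
exists (om_hom_comp x (s k.+1)); apply: om_hom_eq => a y /=.
have := sE k.+1 a y => /=.
rewrite (C0 k.+1 _ a (phi k.+2 a (f k.+2 a y))) // raddf0 subr0 => yE.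
rewrite [in RHS]yE raddfD /=.
have /(congr1 (fun v : om_hom _ _ => v a (s k.+2 a y))) /= -> := dx.
by rewrite add0r.
Qed.

Section Augmented.
Variables (A : module) (P : projective_resolution A).

Definition aug_obj (k : nat) : module := if k is j.+1 then P j else A.

Definition aug_diff (k : nat) : om_hom (aug_obj k.+1) (aug_obj k) :=
  match k with 0 => pr_aug P | j.+1 => pr_diff P j end.

Lemma aug_dd k a x : aug_diff k a (aug_diff k.+1 a x) = 0.
Proof.
by case: k x => [|k] x; [apply/pr_exact0|apply/pr_exact]; exists x.
Qed.

Definition augmented : complex := Complex aug_dd.

Lemma augmented_acyclic : acyclic augmented.
Proof.
by split=> [|[|k]]; [exact: pr_epi|exact: pr_exact0|exact: pr_exact].
Qed.

End Augmented.

Lemma homology_eq0 (A B C : zmodType) (f : {additive A -> B}) (g : {additive B -> C}) :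
  (forall y, g y = 0 -> exists x, f x = y) -> forall h : homology f g, h = 0.
Proof.
move=> fg h; rewrite -(reprK h) -(reprK (0 : homology f g)).
apply/eqmodP; rewrite /= Quotient.equivE unfold_in.
by apply/asboolP/fg; exact: kerP.
Qed.

Lemma Ext_eq0 (A : module) (n : nat) (Q C : complex)
    (i : om_hom A (Q 0)) (phi : forall k, om_hom (Q k) (C k)) (p : om_hom (C 0) A) :
  acyclic Q -> (forall k, projective (C k.+1)) ->
  (forall k, (n < k)%N -> forall a (x : C k.+1 a), x = 0) ->
  chain_map phi -> (forall a x, p a (phi 0 a (i a x)) = x) ->
  forall k M (h : Ext k A M), (n < k)%N -> h = 0.
Proof.
move=> Qac Cproj C0 phiP piP [//|k] M h nk.
apply: homology_eq0 h => x dx.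
apply: (@cocycle_is_coboundary (augmented (free_resolution A)) Q C n i phi p) dx => //.
  by move=> j; exact: (pr_projective (k := j)).
exact: augmented_acyclic.
Qed.

End Complexes.

(** * Chains of tuples *)

(** Identities between formal sums are checked coefficientwise. *)
Ltac chain_ring :=
  apply/eqP/freeg_eqP => ?; rewrite ?(coeffD, coeffN, coeff0); ring.

Section Support.
Variable K : choiceType.
Implicit Types (A B : set K) (c : {freeg K / int}).

Definition supported A c : Prop := forall k, coeff k c != 0 -> A k.

Lemma supp0 A : supported A 0.
Proof. by move=> k; rewrite coeff0 eqxx. Qed.

Lemma suppN A c : supported A c -> supported A (- c).
Proof. by move=> Ac k; rewrite coeffN oppr_eq0; exact: Ac. Qed.

Lemma suppD A c d : supported A c -> supported A d -> supported A (c + d).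
Proof.
move=> Ac Ad k; rewrite coeffD; have [->|+ _] := eqVneq (coeff k c) 0.
  by rewrite add0r; exact: Ad.
exact: Ac.
Qed.

Lemma suppB A c d : supported A c -> supported A d -> supported A (c - d).
Proof. by move=> Ac Ad; apply: suppD Ac _; exact: suppN. Qed.

Lemma suppU A k : A k -> supported A << k >>.
Proof.
by move=> Ak j; rewrite coeffU mul1r; have [<-|_] := eqVneq k j; rewrite ?eqxx.
Qed.

Lemma sub_supp A B c : A `<=` B -> supported A c -> supported B c.
Proof. by move=> AB Ac k /Ac /AB. Qed.

Lemma supp_ind A (P : {freeg K / int} -> Prop) :
  P 0 -> (forall c, P c -> P (- c)) -> (forall c d, P c -> P d -> P (c + d)) ->
  (forall k, A k -> P << k >>) -> forall c, supported A c -> P c.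
Proof.
move=> P0 PN PD PU c Ac; rewrite -(freeg_sumE c).
have PM x m : P x -> P (x *~ m).
  have Pn x' n : P x' -> P (x' *+ n).
    by move=> Px; elim: n => [|n IHn]; rewrite ?mulr0n// mulrS; exact: PD.
  by case: m => n Px; [exact: Pn|rewrite NegzE mulrNz; exact/PN/Pn].
rewrite big_seq_cond; apply: (big_ind P) => // k; rewrite andbT mem_dom => ck.
have -> : << coeff k c *g k >> = << k >> *~ coeff k c :> {freeg K / int}.
  by rewrite freegU_mulz intz.
exact/PM/PU/Ac.
Qed.

Lemma eq_on_supp (V : zmodType) A (f g : {additive {freeg K / int} -> V}) c :
  (forall k, A k -> f << k >> = g << k >>) -> supported A c -> f c = g c.
Proof.
move=> fg; apply: (@supp_ind A (fun c => f c = g c)) => //.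
- by rewrite !raddf0.
- by move=> d; rewrite !raddfN => ->.
- by move=> d d'; rewrite !raddfD => -> ->.
Qed.

End Support.

Lemma supp_map (K L : choiceType) (A : set K) (B : set L)
    (f : {additive {freeg K / int} -> {freeg L / int}}) c :
  (forall k, A k -> supported B (f << k >>)) -> supported A c -> supported B (f c).
Proof.
move=> fAB; apply: (@supp_ind _ A (fun c => supported B (f c))) => //.
- by rewrite raddf0; exact: supp0.
- by move=> d; rewrite raddfN; exact: suppN.
- by move=> d d'; rewrite raddfD; exact: suppD.
Qed.

Notation chain V := {freeg (seq V) / int}.

Section ChainOperators.
Variable V : choiceType.
Implicit Types (x y : V) (s t : seq V) (c : chain V).

Definition cone x : chain V -> chain V := zlift (fun s => << x :: s >>).
HB.instance Definition _ x := GRing.Additive.on (cone x).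

Lemma coneU x s : cone x << s >> = << x :: s >>.
Proof. exact: zliftU. Qed.

(** The alternating sum of the faces, in the recursive form which says that cones
    contract the complex. The empty tuple is the only face of a 1-tuple. *)
Fixpoint bd_seq s : chain V :=
  if s is x :: t then << t >> - cone x (bd_seq t) else 0.

Definition bd : chain V -> chain V := zlift bd_seq.
HB.instance Definition _ := GRing.Additive.on bd.

Lemma bd_nil : bd << [::] >> = 0.
Proof. exact: zliftU. Qed.

Lemma bd_cone x c : bd (cone x c) = c - cone x (bd c).
Proof.
apply: (@freeg_additive_eq _ _ (bd \o cone x) (idfun \- (cone x \o bd))) => s /=.
by rewrite coneU [LHS]zliftU [X in _ = _ - cone x X]zliftU.
Qed.

Lemma bd_cons x s : bd << x :: s >> = << s >> - cone x (bd << s >>).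
Proof. by rewrite -coneU bd_cone. Qed.

Lemma bd_bd c : bd (bd c) = 0.
Proof.
apply: (@freeg_additive_eq _ _ (bd \o bd) \0) => /= s.
elim: s => [|x s IHs]; first by rewrite bd_nil raddf0.
by rewrite bd_cons raddfB /= bd_cone IHs raddf0 subr0 subrr.
Qed.

Lemma supp_cone (A B : set (seq V)) x c :
  (forall s, A s -> B (x :: s)) -> supported A c -> supported B (cone x c).
Proof. by move=> AB; apply: supp_map => s /AB xs /=; rewrite coneU; exact: suppU. Qed.

Lemma supp_bdU s : supported [set t | subseq t s /\ (size t).+1 = size s] (bd << s >>).
Proof.
elim: s => [|x s IHs]; first by rewrite bd_nil; exact: supp0.
rewrite bd_cons; apply: suppB.
  by apply: suppU; split=> //; exact: subseq_cons.
apply: supp_cone IHs => t [ts st] /=; split; last by rewrite st.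
by rewrite eqxx.
Qed.

Lemma supp_bd (A B : set (seq V)) c :
  (forall s t, A s -> subseq t s -> (size t).+1 = size s -> B t) ->
  supported A c -> supported B (bd c).
Proof.
move=> AB; apply: supp_map => s As /=; apply: sub_supp (supp_bdU (s:=s)) => t [ts st].
exact: AB As ts st.
Qed.

End ChainOperators.

Section Push.
Variables V W : choiceType.

Definition push (f : V -> W) : chain V -> chain W := zlift (fun s => << map f s >>).
HB.instance Definition _ f := GRing.Additive.on (push f).

Lemma pushU f s : push f << s >> = << map f s >>.
Proof. exact: zliftU. Qed.

Lemma push_cone f x c : push f (cone x c) = cone (f x) (push f c).
Proof.
apply: (@freeg_additive_eq _ _ (push f \o cone x) (cone (f x) \o push f)) => s /=.
by rewrite coneU !pushU coneU.
Qed.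

Lemma push_bd f c : push f (bd c) = bd (push f c).
Proof.
apply: (@freeg_additive_eq _ _ (push f \o @bd V) (@bd W \o push f)) => /=.
elim=> [|x s IHs]; first by rewrite pushU !bd_nil raddf0.
by rewrite pushU /= !bd_cons raddfB /= push_cone IHs !pushU.
Qed.

Lemma eq_push f g : f =1 g -> push f =1 push g.
Proof.
move=> fg; apply: freeg_additive_eq => s /=.
by rewrite !pushU (eq_map fg).
Qed.

(** The prism operator, in recursive form: the usual sum over the ways of cutting
    a tuple into a first part moved by [f] and a second one moved by [g]. *)
Fixpoint prism_seq (f g : V -> W) (s : seq V) : chain W :=
  if s is x :: t
  then cone (f x) (cone (g x) << map g t >>) - cone (f x) (prism_seq f g t)
  else 0.

Definition prism f g : chain V -> chain W := zlift (prism_seq f g).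
HB.instance Definition _ f g := GRing.Additive.on (prism f g).

Lemma prism_nil f g : prism f g << [::] >> = 0.
Proof. exact: zliftU. Qed.

Lemma prism_cone f g x c :
  prism f g (cone x c) =
  cone (f x) (cone (g x) (push g c)) - cone (f x) (prism f g c).
Proof.
apply: (@freeg_additive_eq _ _ (prism f g \o cone x)
  ((cone (f x) \o cone (g x) \o push g) \- (cone (f x) \o prism f g))) => s /=.
by rewrite coneU pushU [LHS]zliftU [X in _ = _ - cone _ X]zliftU.
Qed.

Lemma prism_homotopy f g c :
  bd (prism f g c) + prism f g (bd c) = push g c - push f c.
Proof.
apply: (@freeg_additive_eq _ _ ((@bd W \o prism f g) \+ (prism f g \o @bd V))
   (push g \- push f)) => /=.
elim=> [|x s IHs]; first by rewrite bd_nil !prism_nil !raddf0 !pushU addr0 subrr.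
rewrite -coneU prism_cone bd_cone !raddfB /= !bd_cone prism_cone !push_cone.
rewrite push_bd !raddfB /=.
move/(congr1 (cone (f x))): IHs; rewrite raddfD raddfB /= => IHs.
have -> : cone (f x) (push f << s >>) = cone (f x) (push g << s >>) -
    (cone (f x) (bd (prism f g << s >>)) + cone (f x) (prism f g (bd << s >>))).
  by rewrite IHs; chain_ring.
chain_ring.
Qed.

End Push.

Section Alternate.
Variables (V : choiceType) (rk : V -> nat).
Implicit Types (x y : V) (s t : seq V) (c : chain V).

(** Exterior multiplication by [x] on strictly increasing tuples. *)
Fixpoint ins_seq x s : chain V :=
  if s is y :: t then
    if (rk x < rk y)%N then << x :: s >>
    else if (rk y < rk x)%N then - cone y (ins_seq x t) else 0
  else << [:: x] >>.

Definition ins x : chain V -> chain V := zlift (ins_seq x).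
HB.instance Definition _ x := GRing.Additive.on (ins x).

Lemma ins_nil x : ins x << [::] >> = << [:: x] >>.
Proof. exact: zliftU. Qed.

Lemma ins_consU x y t : ins x << y :: t >> =
  if (rk x < rk y)%N then << [:: x, y & t] >>
  else if (rk y < rk x)%N then - cone y (ins x << t >>) else 0.
Proof. by rewrite /ins !zliftU. Qed.

Lemma ins_cone_lt x y c : (rk y < rk x)%N -> ins x (cone y c) = - cone y (ins x c).
Proof.
move=> yx; apply: (@freeg_additive_eq _ _ (ins x \o cone y)
  (\- (cone y \o ins x))) => s /=.
by rewrite coneU ins_consU yx ltnNge ltnW.
Qed.

Lemma ins_cone_eq x c : ins x (cone x c) = 0.
Proof.
apply: (@freeg_additive_eq _ _ (ins x \o cone x) \0) => s /=.
by rewrite coneU ins_consU ltnn.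
Qed.

Definition rk_lt x y := (rk x < rk y)%N.

Lemma ins_above x c :
  supported [set s | all (rk_lt x) s] c -> ins x c = cone x c.
Proof.
apply: eq_on_supp => -[|y s] /=; first by rewrite ins_nil coneU.
by move=> /andP[xy _]; rewrite ins_consU -/(rk_lt x y) xy coneU.
Qed.

(** The boundary is an antiderivation of the exterior algebra. Two entries of the
    same rank have to be equal, because [ins] makes their product vanish. *)
Lemma bd_insU x s :
  pairwise rk_lt s -> {in s, forall y, rk y = rk x -> y = x} ->
  bd (ins x << s >>) = << s >> - ins x (bd << s >>).
Proof.
elim: s => [|y s IHs] /=.
  by rewrite ins_nil bd_nil bd_cons bd_nil !raddf0 !addr0.
move=> /andP[ys sP] inj; rewrite ins_consU.
have {}IHs : bd (ins x << s >>) = << s >> - ins x (bd << s >>).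
  by apply: IHs => // z zs; apply: inj; rewrite inE zs orbT.
case: ltngtP => [xy|yx|xy].
- rewrite -coneU bd_cone; congr (_ - _); rewrite ins_above //.
  apply: (@supp_bd _ [set s | all (rk_lt x) s]).
    move=> t u /allP tx ut _; apply/allP => z zu.
    by apply: tx; exact: mem_subseq ut _ zu.
  apply: suppU; rewrite /= {1}/rk_lt xy /=.
  by apply: sub_all ys => z; exact: ltn_trans.
- rewrite raddfN /= bd_cone IHs bd_cons !raddfB /= ins_cone_lt // -coneU.
  chain_ring.
- have yx : y = x by apply: inj; rewrite ?inE ?eqxx.
  rewrite {y xy inj}yx in ys *.
  rewrite raddf0 bd_cons raddfB /= ins_cone_eq subr0 ins_above ?coneU ?subrr //.
  exact: suppU.
Qed.

Lemma supp_insU x s : pairwise rk_lt s ->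
  supported [set t | [/\ pairwise rk_lt t, {subset t <= x :: s} & size t = (size s).+1]]
    (ins x << s >>).
Proof.
elim: s => [|y s IHs] /=; first by rewrite ins_nil => _; apply: suppU; split.
move=> /andP[ys sP]; rewrite ins_consU; case: ltngtP => xy.
- apply: suppU; split=> //=; rewrite ys sP {1}/rk_lt xy /= !andbT.
  by apply: sub_all ys => z; exact: ltn_trans.
- apply: suppN; apply: supp_cone (IHs sP) => t [tP ts st] /=; split.
  + rewrite tP andbT; apply/allP => z /ts; rewrite inE => /predU1P[->//|].
    exact: (allP ys).
  + move=> z; rewrite !inE => /predU1P[->|/ts]; first by rewrite eqxx orbT.
    by rewrite inE => /orP[] ->; rewrite ?orbT.
  + by rewrite st.
- exact: supp0.
Qed.

(** The projection of the complex of all tuples onto that of the increasing ones: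
    a tuple goes to the signed rearrangement of its entries, or to 0. *)
Fixpoint alt_seq s : chain V :=
  if s is x :: t then ins x (alt_seq t) else << [::] >>.

Definition alt : chain V -> chain V := zlift alt_seq.
HB.instance Definition _ := GRing.Additive.on alt.

Lemma alt_nil : alt << [::] >> = << [::] >>.
Proof. exact: zliftU. Qed.

Lemma alt_cone x c : alt (cone x c) = ins x (alt c).
Proof.
apply: (@freeg_additive_eq _ _ (alt \o cone x) (ins x \o alt)) => s /=.
by rewrite coneU /alt !zliftU.
Qed.

Lemma supp_altU s :
  supported [set t | [/\ pairwise rk_lt t, {subset t <= s} & size t = size s]]
    (alt << s >>).
Proof.
elim: s => [|x s IHs]; first by rewrite alt_nil; apply: suppU; split.
rewrite -coneU alt_cone; apply: supp_map IHs => t [tP ts st] /=.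
apply: sub_supp (supp_insU (x:=x) tP) => u [uP us su]; split=> //.
  move=> z /us; rewrite !inE => /orP[->//|/ts ->]; exact: orbT.
by rewrite su st.
Qed.

Lemma bd_altU s : {in s &, injective rk} -> bd (alt << s >>) = alt (bd << s >>).
Proof.
elim: s => [|x s IHs] inj; first by rewrite alt_nil !bd_nil raddf0.
rewrite -coneU alt_cone bd_cone raddfB /= alt_cone -IHs; last first.
  by move=> y z ys zs; apply: inj; rewrite inE ?ys ?zs orbT.
apply: (eq_on_supp (f := @bd _ \o ins x) (g := idfun \- (ins x \o @bd _)) _
  (supp_altU (s:=s))) => t [tP ts _] /=.
rewrite bd_insU // => y /ts ys; apply: inj; rewrite inE ?eqxx //.
by rewrite ys orbT.
Qed.

End Alternate.

Section AlternatePush.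
Variables (V W : choiceType) (rk : V -> nat) (rk' : W -> nat) (g : V -> W).
Hypothesis gP : forall x, rk' (g x) = rk x.

Lemma push_ins x c : push g (ins rk x c) = ins rk' (g x) (push g c).
Proof.
apply: (@freeg_additive_eq _ _ (push g \o ins rk x) (ins rk' (g x) \o push g)) => /=.
elim=> [|y s IHs]; first by rewrite ins_nil !pushU ins_nil.
rewrite pushU /= !ins_consU !gP; case: ltngtP => xy; last by rewrite raddf0.
  by rewrite pushU.
by rewrite raddfN /= push_cone IHs pushU.
Qed.

Lemma push_alt c : push g (alt rk c) = alt rk' (push g c).
Proof.
apply: (@freeg_additive_eq _ _ (push g \o alt rk) (alt rk' \o push g)) => /=.
elim=> [|x s IHs]; first by rewrite pushU !alt_nil pushU.
by rewrite -coneU push_cone !alt_cone push_ins IHs.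
Qed.

End AlternatePush.

(** * Chains with restricted support, and morphisms of the orbit category *)

Section SupportedChains.
Variables (K : choiceType) (A : set K).

Definition supp_pred : {pred {freeg K / int}} := fun c => `[< supported A c >].

Lemma supp_predP c : reflect (supported A c) (c \in supp_pred).
Proof. by rewrite unfold_in; exact: asboolP. Qed.

Lemma supp_zmod_closed : zmod_closed supp_pred.
Proof.
split=> [|c d]; first by apply/supp_predP; exact: supp0.
by move=> /supp_predP Ac /supp_predP Ad; apply/supp_predP; exact: suppB.
Qed.

HB.instance Definition _ :=
  GRing.isZmodClosed.Build {freeg K / int} supp_pred supp_zmod_closed.

Definition chains_on : Type := {c : {freeg K / int} | c \in supp_pred}.

HB.instance Definition _ := SubChoice.on chains_on.
HB.instance Definition _ := [SubChoice_isSubZmodule of chains_on by <:].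

Lemma chains_onP (c : chains_on) : supported A (val c).
Proof. by apply/supp_predP; exact: valP. Qed.

Definition Chains c (Ac : supported A c) : chains_on :=
  Sub c (introT (supp_predP c) Ac).

(** Induction over generators that belong to the subgroup, which is why the support
    is carried along in the proof. *)
Lemma chains_on_ind (P : chains_on -> Prop) :
  P 0 -> (forall c, P c -> P (- c)) -> (forall c d, P c -> P d -> P (c + d)) ->
  (forall k (Ak : A k), P (Chains (suppU Ak))) -> forall c, P c.
Proof.
move=> P0 PN PD PU c.
have PE d (Ad : supported A d) (e : chains_on) : val e = d -> P e -> P (Chains Ad).
  by move=> ed; congr P; apply: val_inj; rewrite /= -ed.
suff [Ac Pc] : exists Ac : supported A (val c), P (Chains Ac).
  by have -> : c = Chains Ac by exact: val_inj.
apply: (@supp_ind _ A (fun d => exists Ad : supported A d, P (Chains Ad))).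
- by exists (@supp0 _ A); apply: PE P0.
- by move=> d [Ad Pd]; exists (suppN Ad); apply: PE (PN _ Pd).
- move=> d e [Ad Pd] [Ae Pe]; exists (suppD Ad Ae).
  by apply: PE (PD _ _ Pd Pe).
- by move=> k Ak; exists (suppU Ak); exact: PU.
- exact: chains_onP.
Qed.

End SupportedChains.

Section RestrictedMap.
Variables (K L : choiceType) (A : set K) (B : set L).
Variable f : {additive {freeg K / int} -> {freeg L / int}}.
Hypothesis fAB : forall k, A k -> supported B (f << k >>).

Definition chains_map (c : chains_on A) : chains_on B :=
  Chains (supp_map fAB (chains_onP (c:=c))).

Lemma chains_map_is_additive : zmod_morphism chains_map.
Proof. by move=> c d; apply: val_inj; rewrite /= raddfB. Qed.

HB.instance Definition _ :=
  GRing.isZmodMorphism.Build (chains_on A) (chains_on B) chains_map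
    chains_map_is_additive.

End RestrictedMap.

Section OrbitMorphisms.
Local Open Scope group_scope.
Variables (G : groupType) (F : set (set G)).
Hypothesis Fsub : F `<=` @is_subgroup G.
Local Notation obj := (orbit_obj F).

Lemma left_cosetP (H : set G) (g h : G) : is_subgroup H ->
  left_coset g H = left_coset h H <-> H (g^-1 * h).
Proof.
move=> [H1 HM HV]; split=> [gh|gh].
  have [k Hk <-] : left_coset g H h by rewrite gh; exists 1; rewrite ?mulg1.
  by rewrite mulKg.
apply/seteqP; split=> _ [k Hk <-].
  exists ((g^-1 * h)^-1 * k); first by apply: HM => //; exact: HV.
  by rewrite invgM invgK !mulgA mulgV mul1g.
exists (g^-1 * h * k); first exact: HM.
by rewrite !mulgA mulgV mul1g.
Qed.

Definition base_coset (H : set G) : coset_space H :=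
  exist _ (left_coset 1 H) (ex_intro _ 1 erefl).

Lemma coset_space_eq (H : set G) (C D : coset_space H) : sval C = sval D -> C = D.
Proof.
by case: C D => C CP [D DP] /= CD; case: _ / CD in DP *; congr exist; exact: Prop_irrelevance.
Qed.

Lemma coset_space_transitive (H : set G) (C : coset_space H) :
  exists g, C = coset_act g (base_coset H).
Proof.
case: C => C [g CE]; exists g; apply: coset_space_eq => /=.
by rewrite left_cosetM mulg1.
Qed.

Definition coset_rep (H : set G) (C : coset_space H) : G := sval (cid (svalP C)).

Lemma coset_repP (H : set G) (C : coset_space H) : sval C = left_coset (coset_rep C) H.
Proof. by rewrite /coset_rep; case: cid. Qed.

(** A map out of G/H is determined by the image of the coset H; [morph_rep] is an
    element of that image. *)
Definition morph_rep (a b : obj) (u : orbit_hom a b) : G :=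
  coset_rep (u (base_coset (sval a))).

Lemma morph_eq (a b : obj) (u v : orbit_hom a b) :
  sval b ((morph_rep u)^-1 * morph_rep v) -> u = v.
Proof.
move=> uv; apply: gmap_eq => C; have [g ->] := coset_space_transitive C.
rewrite !gmapP; congr coset_act; apply: coset_space_eq; rewrite !coset_repP.
by apply/left_cosetP => //; exact: Fsub (svalP b).
Qed.

Lemma morph_rep_fix (a b : obj) (u : orbit_hom a b) h :
  sval a h -> sval b ((morph_rep u)^-1 * (h * morph_rep u)).
Proof.
move=> ah; have aS := Fsub (svalP a); have bS := Fsub (svalP b).
apply/left_cosetP => //; rewrite -left_cosetM -!coset_repP.
rewrite -[RHS]/(sval (coset_act h (u (base_coset (sval a))))) -gmapP.
congr (sval (u _)); apply: coset_space_eq; rewrite /= left_cosetM mulg1.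
by apply/left_cosetP; rewrite // invg1 mul1g.
Qed.

Lemma morph_rep_id (a : obj) :
  sval a (morph_rep (gmap_id (sval a) : orbit_hom a a)).
Proof.
have aS := Fsub (svalP a).
rewrite -[morph_rep _]mul1g -invg1; apply/left_cosetP => //.
by rewrite /morph_rep -coset_repP.
Qed.

Lemma morph_rep_comp (a b c : obj) (u : orbit_hom a b) (v : orbit_hom b c) :
  sval c ((morph_rep u * morph_rep v)^-1 * morph_rep (gmap_comp v u : orbit_hom a c)).
Proof.
have cS := Fsub (svalP c); apply/left_cosetP => //.
rewrite -left_cosetM -!coset_repP /=.
have -> : u (base_coset (sval a)) = coset_act (morph_rep u) (base_coset (sval b)).
  by apply: coset_space_eq; rewrite /= left_cosetM mulg1 coset_repP.
by rewrite gmapP.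
Qed.

Lemma morph_exists (a b : obj) (g : G) :
  (forall h, sval a h -> sval b (g^-1 * (h * g))) ->
  exists u : orbit_hom a b, sval b (g^-1 * morph_rep u).
Proof.
move=> ag; have aS := Fsub (svalP a); have bS := Fsub (svalP b).
have wd (C : coset_space (sval a)) :
    exists k, left_coset (coset_rep C * g) (sval b) = left_coset k (sval b).
  by exists (coset_rep C * g).
pose f C : coset_space (sval b) := exist _ _ (wd C).
have fP x C : f (coset_act x C) = coset_act x (f C).
  apply: coset_space_eq; rewrite /= left_cosetM mulgA.
  apply/left_cosetP => //.
  have /left_cosetP : left_coset (coset_rep (coset_act x C)) (sval a) =
      left_coset (x * coset_rep C) (sval a).
    by rewrite -coset_repP /= coset_repP left_cosetM.
  move=> /(_ aS) /ag; congr (sval b _).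
  by rewrite !invgM !mulgA.
exists (GMap fP); apply/left_cosetP => //; rewrite /morph_rep -coset_repP /=.
apply/left_cosetP => //.
have /left_cosetP := coset_repP (base_coset (sval a)).
rewrite invg1 mul1g => /(_ aS) /ag; congr (sval b _).
Qed.

End OrbitMorphisms.

Lemma stabilizer_subgroup (G : groupType) (T : Type) (act : G -> T -> T) (s : T) :
  action_law act -> is_subgroup (stabilizer act s).
Proof.
move=> actP; split=> [|g h gs hs|g gs]; rewrite /stabilizer /=; first exact: actP.1.
  by rewrite actP.2 hs gs.
by rewrite -{1}gs -actP.2 mulVg actP.1.
Qed.

(** * Permutation modules *)

Section PermutationModule.
Variables (G : groupType) (F : set (set G)).
Hypothesis Fsub : F `<=` @is_subgroup G.
Local Notation obj := (orbit_obj F).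
Variables (S : choiceType) (act : G -> S -> S).
Hypothesis actP : action_law act.
Variable A : set S.
Hypothesis A_act : forall g s, A s -> A (act g s).

Definition fixpts (H : set G) : set S :=
  [set s | A s /\ forall h, H h -> act h s = s].

Definition gact (g : G) : {freeg S / int} -> {freeg S / int} :=
  zlift (fun s => << act g s >>).
HB.instance Definition _ g := GRing.Additive.on (gact g).

Lemma gactU g s : gact g << s >> = << act g s >>.
Proof. exact: zliftU. Qed.

Lemma act_coset (H : set G) g h s :
  fixpts H s -> H (g^-1 * h)%g -> act h s = act g s.
Proof. by move=> [_ sH] /sH gs; rewrite -[in RHS]gs -actP.2 mulVKg. Qed.

Lemma morph_rep_fixpts (a b : obj) (u : orbit_hom a b) s :
  fixpts (sval b) s -> fixpts (sval a) (act (morph_rep u) s).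
Proof.
move=> bs; split; first exact: A_act bs.1.
move=> h ah; rewrite -actP.2; apply: act_coset bs _.
exact: morph_rep_fix.
Qed.

Lemma supp_gact_rep (a b : obj) (u : orbit_hom a b) s :
  fixpts (sval b) s -> supported (fixpts (sval a)) (gact (morph_rep u) << s >>).
Proof. by move=> bs; rewrite gactU; apply: suppU; exact: morph_rep_fixpts. Qed.

Definition perm_map (a b : obj) (u : orbit_hom a b) :
    chains_on (fixpts (sval b)) -> chains_on (fixpts (sval a)) :=
  chains_map (f := gact (morph_rep u)) (@supp_gact_rep a b u).
HB.instance Definition _ a b u := GRing.Additive.on (@perm_map a b u).

Lemma perm_map_id a x : perm_map (gmap_id (sval a) : orbit_hom a a) x = x.
Proof.
apply: val_inj => /=; apply: (eq_on_supp (g := idfun) _ (chains_onP (c:=x))) => s [_ sa] /=.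
by rewrite gactU sa //; exact: morph_rep_id.
Qed.

Lemma perm_map_comp (a b c : obj) (u : orbit_hom a b) (v : orbit_hom b c) x :
  perm_map (gmap_comp v u : orbit_hom a c) x = perm_map u (perm_map v x).
Proof.
apply: val_inj => /=.
apply: (eq_on_supp (g := gact (morph_rep u) \o gact (morph_rep v)) _
  (chains_onP (c:=x))) => s sc /=.
rewrite !gactU -actP.2; congr << _ >>; apply: act_coset sc _.
exact: morph_rep_comp.
Qed.

(** On G/H, the free abelian group on the H-fixed points of [A]. *)
Definition perm_module : orbit_module F := OrbitModule perm_map_id perm_map_comp.

(** The representative depends on the orbit only ([orbit_rep_act]). *)
Definition orbit_rep s : S := xget s (action_orbit act s).

Lemma orbit_rep_in s : exists g, act g (orbit_rep s) = s.
Proof.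
have [g _ <-] : action_orbit act s (orbit_rep s).
  by apply: xgetPex; exists s, 1%g; rewrite ?actP.1.
by exists g^-1%g; rewrite -actP.2 mulVg actP.1.
Qed.

Lemma orbit_rep_act g s : orbit_rep (act g s) = orbit_rep s.
Proof.
suff oE : action_orbit act (act g s) = action_orbit act s.
  rewrite /orbit_rep oE /xget; case: pselect => // -[].
  by exists s; apply/asboolP; exists 1%g; rewrite ?actP.1.
apply/seteqP; split=> _ [h _ <-].
  by exists (h * g)%g; rewrite ?actP.2.
by exists (h * g^-1)%g; rewrite // -actP.2 -mulgA mulVg mulg1.
Qed.

Section Projective.
Hypothesis stabF : forall s, A s -> F (stabilizer act s).

Lemma A_rep s : A s -> A (orbit_rep s).
Proof.
have [g gs] := orbit_rep_in s => /(A_act g^-1%g).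
by rewrite -{1}gs -actP.2 mulVg actP.1.
Qed.

Definition rep_obj s (As : A s) : obj := exist _ _ (stabF (A_rep As)).

Lemma rep_fixpts s (As : A s) : fixpts (sval (rep_obj As)) (orbit_rep s).
Proof. by split; [exact: A_rep|]. Qed.

Lemma rep_morph_ex (a : obj) s (sa : fixpts (sval a) s) :
  exists u : orbit_hom a (rep_obj sa.1), act (morph_rep u) (orbit_rep s) = s.
Proof.
have [g gs] := orbit_rep_in s.
have [h ah|u uP] := @morph_exists _ _ Fsub a (rep_obj sa.1) g.
  by rewrite /= /stabilizer /= !actP.2 gs sa.2 // -{1}gs -actP.2 mulVg actP.1.
by exists u; rewrite -[RHS]gs; apply: act_coset (rep_fixpts sa.1) uP.
Qed.

Definition rep_morph (a : obj) s (sa : fixpts (sval a) s) :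
  orbit_hom a (rep_obj sa.1) := sval (cid (rep_morph_ex sa)).

Lemma rep_morphP (a : obj) s (sa : fixpts (sval a) s) :
  act (morph_rep (rep_morph sa)) (orbit_rep s) = s.
Proof. by rewrite /rep_morph; case: cid. Qed.

Definition gen (a : obj) s (sa : fixpts (sval a) s) : perm_module a :=
  Chains (suppU sa).

(** A permutation module with stabilizers in [F] is free: an [H]-fixed point
    is a morphism from G/H to its orbit. *)
Lemma perm_module_projective : projective perm_module.
Proof.
move=> M N e g e_epi.
have [m mE] : exists m : forall r (Ar : F (stabilizer act r)), M (exist _ _ Ar),
    forall r (Ar : F (stabilizer act r)) (rr : fixpts (stabilizer act r) r),
    e (exist _ _ Ar) (m r Ar) = g (exist _ _ Ar) (@gen (exist _ _ Ar) r rr).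
  have ex r (Ar : F (stabilizer act r)) : exists x : M (exist _ _ Ar),
      forall rr : fixpts (stabilizer act r) r,
      e (exist _ _ Ar) x = g (exist _ _ Ar) (@gen (exist _ _ Ar) r rr).
    have [rr|nrr] := pselect (fixpts (stabilizer act r) r); last by exists 0.
    have [x xE] := e_epi _ (g (exist _ _ Ar) (@gen (exist _ _ Ar) r rr)).
    by exists x => rr'; rewrite xE; congr (g _ _); exact: val_inj.
  exists (fun r Ar => sval (cid (ex r Ar))) => r Ar.
  by case: cid.
(* Off the fixed points the value is arbitrary. *)
pose lift (a : obj) (s : S) : M a :=
  if pselect (fixpts (sval a) s) is left sa
  then om_map M (rep_morph sa) (m _ (stabF (A_rep sa.1))) else 0.
have liftE (a : obj) s r (Ar : F (stabilizer act r))
    (u : orbit_hom a (exist _ _ Ar)) : fixpts (sval a) s ->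
    r = orbit_rep s -> act (morph_rep u) r = s -> lift a s = om_map M u (m r Ar).
  move=> sa rE us; rewrite /lift; case: pselect => // {}sa.
  subst r; rewrite (Prop_irrelevance Ar (stabF (A_rep sa.1))) in u us *.
  congr (om_map M _ _); apply: morph_eq => //=.
  rewrite /stabilizer /= actP.2 us.
  have := congr1 (act (morph_rep (rep_morph sa))^-1%g) (rep_morphP sa).
  by rewrite -actP.2 mulVg actP.1.
have lift_nat (a b : obj) (v : orbit_hom a b) s : fixpts (sval b) s ->
    lift a (act (morph_rep v) s) = om_map M v (lift b s).
  move=> sb; have Ar := stabF (A_rep sb.1).
  rewrite (liftE b s _ _ (rep_morph sb)) ?rep_morphP //.
  rewrite -om_comp; apply: liftE; first exact: morph_rep_fixpts.
    by rewrite orbit_rep_act.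
  rewrite (act_coset (rep_fixpts sb.1) (morph_rep_comp Fsub v (rep_morph sb))).
  by rewrite actP.2 rep_morphP.
pose h a : {additive perm_module a -> M a} := zlift (lift a) \o val.
have h_nat (a b : obj) (v : orbit_hom a b) x :
    h a (om_map perm_module v x) = om_map M v (h b x).
  apply: (eq_on_supp (f := zlift (lift a) \o gact (morph_rep v))
    (g := om_map M v \o zlift (lift b)) _ (chains_onP (c:=x))) => s sb /=.
  by rewrite gactU !zliftU lift_nat.
exists (OmHom h_nat); apply: om_hom_eq => a /=; apply: chains_on_ind => /=.
- by rewrite !raddf0.
- by move=> x; rewrite !raddfN /= => ->.
- by move=> x y; rewrite !raddfD /= => -> ->.
move=> s sa; rewrite zliftU.
rewrite (liftE a s _ _ (rep_morph sa)) ?rep_morphP // oh_nat.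
rewrite (mE _ _ (rep_fixpts sa.1)) -oh_nat; congr (g _ _); apply: val_inj => /=.
by rewrite gactU rep_morphP.
Qed.

End Projective.
End PermutationModule.

(** * Complexes of tuples and the nerve criterion *)

Section PermutationHom.
Variables (G : groupType) (F : set (set G)).
Hypothesis Fsub : F `<=` @is_subgroup G.
Variables (S T : choiceType) (act : G -> S -> S) (act' : G -> T -> T).
Hypotheses (actP : action_law act) (actP' : action_law act').
Variables (A : set S) (B : set T).
Hypothesis A_act : forall g s, A s -> A (act g s).
Hypothesis B_act : forall g s, B s -> B (act' g s).
Variable f : {additive {freeg S / int} -> {freeg T / int}}.
Hypothesis f_fix : forall (a : orbit_obj F) s, fixpts act A (sval a) s ->
  supported (fixpts act' B (sval a)) (f << s >>).
Hypothesis f_act : forall g s, A s -> f << act g s >> = gact act' g (f << s >>).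

Lemma perm_hom_nat (a b : orbit_obj F) (u : orbit_hom a b)
    (x : chains_on (fixpts act A (sval b))) :
  chains_map (f_fix (a := a)) (om_map (perm_module Fsub actP A_act) u x) =
  om_map (perm_module Fsub actP' B_act) u (chains_map (f_fix (a := b)) x).
Proof.
apply: val_inj => /=.
apply: (eq_on_supp (f := f \o gact act (morph_rep u))
  (g := gact act' (morph_rep u) \o f) _ (chains_onP (c:=x))) => s [As _] /=.
by rewrite gactU f_act.
Qed.

Definition perm_hom : om_hom (perm_module Fsub actP A_act)
    (perm_module Fsub actP' B_act) :=
  @OmHom _ _ (perm_module Fsub actP A_act) (perm_module Fsub actP' B_act)
    (fun a => chains_map (f_fix (a := a))) perm_hom_nat.

End PermutationHom.

Section TupleComplex.
Variables (G : groupType) (F : set (set G)).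
Hypothesis Fsub : F `<=` @is_subgroup G.
Variables (V : choiceType) (act : G -> V -> V).
Hypothesis actP : action_law act.
Variable A : set (seq V).
Hypothesis A_act : forall g s, A s -> A (map (act g) s).
Hypothesis A_face : forall s t, A s -> subseq t s -> A t.

Definition tuple_act (g : G) : seq V -> seq V := map (act g).

Lemma tuple_actP : action_law tuple_act.
Proof.
split=> [s|g h s]; rewrite /tuple_act.
  by rewrite (eq_map actP.1) map_id.
by rewrite (eq_map (actP.2 g h)) map_comp.
Qed.

Lemma tuple_fixP g s : tuple_act g s = s <-> {in s, forall x, act g x = x}.
Proof. by rewrite -{2}(map_id s); split=> [/eq_in_map|/eq_in_map]. Qed.

Definition tuples (k : nat) : set (seq V) := [set s | A s /\ size s = k].

Lemma tuples_act k g s : tuples k s -> tuples k (tuple_act g s).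
Proof. by move=> [As <-]; split; [exact: A_act|rewrite size_map]. Qed.

Definition tuple_module (k : nat) : orbit_module F :=
  perm_module Fsub tuple_actP (@tuples_act k).

Lemma supp_bd_fix k (H : set G) c : supported (fixpts tuple_act (tuples k.+1) H) c ->
  supported (fixpts tuple_act (tuples k) H) (bd c).
Proof.
apply: supp_bd => s t [[As sk] sH] ts st; split.
  by split; [exact: A_face ts|move: st; rewrite sk => -[]].
move=> h Hh; apply/tuple_fixP => x /(mem_subseq ts).
by have /tuple_fixP := sH h Hh; apply.
Qed.

Lemma tuple_bd_fix k (a : orbit_obj F) s : fixpts tuple_act (tuples k.+1) (sval a) s ->
  supported (fixpts tuple_act (tuples k) (sval a)) (bd << s >>).
Proof. by move=> sa; apply: supp_bd_fix; exact: suppU. Qed.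

Lemma tuple_bd_act k g s : tuples k s ->
  bd << tuple_act g s >> = gact tuple_act g (bd << s >>).
Proof. by move=> _; rewrite /gact -/(push _ _) push_bd pushU. Qed.

Definition tuple_diff k : om_hom (tuple_module k.+1) (tuple_module k) :=
  perm_hom Fsub tuple_actP tuple_actP (@tuples_act k.+1) (@tuples_act k)
    (@tuple_bd_fix k) (@tuple_bd_act k.+1).

Lemma tuple_dd k a x : tuple_diff k a (tuple_diff k.+1 a x) = 0.
Proof. by apply: val_inj => /=; rewrite bd_bd. Qed.

Definition tuple_complex : complex F := Complex tuple_dd.

Lemma tuple_complex_acyclic :
  (forall H k z, F H -> supported (fixpts tuple_act (tuples k) H) z -> bd z = 0 ->
    exists2 w, supported (fixpts tuple_act (tuples k.+1) H) w & bd w = z) ->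
  acyclic tuple_complex.
Proof.
move=> fill.
have ex k a (z : tuple_module k a) : bd (val z) = 0 ->
    exists w, tuple_diff k a w = z.
  move=> z0; have [w wP wz] := fill _ k _ (svalP a) (chains_onP (c := z)) z0.
  by exists (Chains wP); exact: val_inj.
split=> [a z|k a z].
  apply: ex; apply: (eq_on_supp (g := \0) _ (chains_onP (c := z))).
  by move=> s [[_ /size0nil ->] _] /=; rewrite bd_nil.
split=> [z0|[w <-]]; last exact: tuple_dd.
by apply: ex; have /(congr1 val) := z0.
Qed.

Hypothesis A_nil : A [::].

Lemma supp_empty_tuple H (m : int) :
  supported (fixpts tuple_act (tuples 0) H) << m *g [::] >>.
Proof.
move=> s; rewrite coeffU; case: ([::] =P s) => [<- _|_]; first by split.
by rewrite mulr0 eqxx.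
Qed.

Definition empty_tuple (a : orbit_obj F) (m : constZ F a) : tuple_module 0 a :=
  Chains (@supp_empty_tuple (sval a) m).

Lemma empty_tuple_is_additive a : zmod_morphism (@empty_tuple a).
Proof. by move=> x y; apply: val_inj; rewrite /= freegUB. Qed.
HB.instance Definition _ a := GRing.isZmodMorphism.Build
  (constZ F a) (tuple_module 0 a) (@empty_tuple a) (@empty_tuple_is_additive a).

Lemma empty_tuple_nat (a b : orbit_obj F) (u : orbit_hom a b) x :
  @empty_tuple a (om_map (constZ F) u x) = om_map (tuple_module 0) u (@empty_tuple b x).
Proof.
apply: val_inj => /=; have -> : << x *g [::] >> = << [::] >> *~ x :> chain V.
  by rewrite freegU_mulz intz.
by rewrite raddfMz /= gactU.
Qed.

Definition augment_section : om_hom (constZ F) (tuple_module 0) :=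
  @OmHom _ _ (constZ F) (tuple_module 0) (fun a => @empty_tuple a) empty_tuple_nat.

Definition empty_coeff (a : orbit_obj F) (x : tuple_module 0 a) : constZ F a :=
  coeff [::] (val x).

Lemma empty_coeff_is_additive a : zmod_morphism (@empty_coeff a).
Proof. by move=> x y; rewrite /empty_coeff -coeffB. Qed.
HB.instance Definition _ a := GRing.isZmodMorphism.Build
  (tuple_module 0 a) (constZ F a) (@empty_coeff a) (@empty_coeff_is_additive a).

Lemma empty_coeff_nat (a b : orbit_obj F) (u : orbit_hom a b) x :
  @empty_coeff a (om_map (tuple_module 0) u x) = om_map (constZ F) u (@empty_coeff b x).
Proof.
rewrite /empty_coeff /=.
apply: (eq_on_supp (f := coeff [::] \o gact tuple_act (morph_rep u))
  (g := coeff [::]) _ (chains_onP (c:=x))) => s [[_ /size0nil ->] _] /=.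
by rewrite gactU.
Qed.

Definition augment : om_hom (tuple_module 0) (constZ F) :=
  @OmHom _ _ (tuple_module 0) (constZ F) (fun a => @empty_coeff a) empty_coeff_nat.

End TupleComplex.

Section NerveCriterion.
Variables (G : groupType) (F : set (set G)).
Hypothesis Ffam : is_family F.
Variables (V W : choiceType) (actV : G -> V -> V) (actW : G -> W -> W).
Hypotheses (actVP : action_law actV) (actWP : action_law actW).
Variables (A : set (seq V)) (N : set (seq W)) (rk : W -> nat) (phi : V -> W) (n : nat).
Hypothesis A_act : forall g s, A s -> A (map (actV g) s).
Hypothesis A_face : forall s t, A s -> subseq t s -> A t.
Hypothesis A_nil : A [::].
Hypothesis A_fill : forall H k z, F H ->
  supported (fixpts (tuple_act actV) (tuples A k) H) z -> bd z = 0 ->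
  exists2 w, supported (fixpts (tuple_act actV) (tuples A k.+1) H) w & bd w = z.
Hypothesis N_act : forall g s, N s -> N (map (actW g) s).
Hypothesis N_sub : forall s t, N s -> {subset t <= s} -> N t.
Hypothesis N_rk : forall s, N s -> {in s &, injective rk}.
Hypothesis N_size : forall s, N s -> uniq s -> (size s <= n.+1)%N.
Hypothesis N_stab : forall s w, N s -> w \in s -> F (stabilizer actW w).
Hypothesis rk_act : forall g w, rk (actW g w) = rk w.
Hypothesis phi_act : forall g v, phi (actV g v) = actW g (phi v).
Hypothesis phi_N : forall s, A s -> N (map phi s).

Let Fsub : F `<=` @is_subgroup G. Proof. by case: Ffam. Qed.

Let B := [set s | N s /\ pairwise (rk_lt rk) s].

Let B_act g s : B s -> B (map (actW g) s).
Proof.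
move=> [Ns sP]; split; first exact: N_act.
rewrite pairwise_map; apply: sub_pairwise sP => x y.
by rewrite /rk_lt /= !rk_act.
Qed.

Let B_face s t : B s -> subseq t s -> B t.
Proof.
move=> [Ns sP] ts; split; last exact: subseq_pairwise ts sP.
by apply: N_sub Ns _; exact: mem_subseq.
Qed.

Let Q := tuple_complex Fsub actVP A_act A_face.
Let C := tuple_complex Fsub actWP B_act B_face.

Let C_projective k : projective (C k.+1).
Proof.
apply: perm_module_projective => -[[]//|w s [[Ns _] _]].
have [_ _ Fdown] := Ffam; apply: Fdown (N_stab Ns (mem_head w s)) _ _.
  exact: stabilizer_subgroup (tuple_actP actWP).
by move=> g /tuple_fixP; apply; exact: mem_head.
Qed.

Let C_dim k : (n < k)%N -> forall a (x : C k.+1 a), x = 0.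
Proof.
move=> nk a x; apply: val_inj => /=.
apply: (eq_on_supp (f := idfun) (g := \0) _ (chains_onP (c := x))).
move=> s [[[Ns sP] sk] _]; have := N_size Ns.
rewrite sk ltnS leqNgt nk => /(_ _) /notF; case.
have rk_irr : irreflexive (rk_lt rk) by move=> y; rewrite /rk_lt ltnn.
exact: pairwise_uniq rk_irr sP.
Qed.

Definition nerve_map : chain V -> chain W := alt rk \o push phi.
HB.instance Definition _ := GRing.Additive.on nerve_map.

Let nerve_fix k (a : orbit_obj F) s :
  fixpts (tuple_act actV) (tuples A k) (sval a) s ->
  supported (fixpts (tuple_act actW) (tuples B k) (sval a)) (nerve_map << s >>).
Proof.
move=> [[As sk] sa]; rewrite /nerve_map /= pushU.
apply: sub_supp (supp_altU (s := map phi s)) => t [tP ts st]; split.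
  by split; [split=> //; exact: N_sub (phi_N As) ts|rewrite st size_map].
move=> h ah; apply/tuple_fixP => w /ts /mapP[v vs ->].
by rewrite -phi_act; have /tuple_fixP -> := sa h ah.
Qed.

Let nerve_act k g s : tuples A k s ->
  nerve_map << tuple_act actV g s >> = gact (tuple_act actW) g (nerve_map << s >>).
Proof.
move=> _; rewrite /nerve_map /gact /= -/(push _ _) (push_alt (rk' := rk)) //.
rewrite !pushU /tuple_act -!map_comp; congr (alt rk << _ >>).
by apply: eq_map => v /=; rewrite phi_act.
Qed.

Let Phi k : om_hom (Q k) (C k) :=
  perm_hom Fsub (tuple_actP actVP) (tuple_actP actWP)
    (tuples_act A_act (k := k)) (tuples_act B_act (k := k))
    (@nerve_fix k) (@nerve_act k).

(** Here [A] is the set of tuples of a simplicial complex on [V] which is acyclic on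
    fixed points, and [N] lists the vertices of the simplices of a nerve on [W],
    with repetitions. The invariant rank orders every simplex, so the increasing
    tuples are oriented simplices that the group permutes without signs. *)
Lemma nerve_Ext_eq0 k M (h : Ext k (constZ F) M) : (n < k)%N -> h = 0.
Proof.
have B_nil : B [::] by split=> //; exact: N_sub (phi_N A_nil) _.
apply: (@Ext_eq0 _ _ (constZ F) n Q C (augment_section Fsub actVP A_act A_nil)
   Phi (augment Fsub actWP B_act)) => //.
- exact: tuple_complex_acyclic.
- move=> j a x; apply: val_inj => /=.
  apply: (eq_on_supp (f := nerve_map \o @bd V) (g := @bd W \o nerve_map) _
    (chains_onP (c := x))) => s [[As _] _] /=.
  rewrite /nerve_map /= push_bd pushU bd_altU //; exact: N_rk (phi_N As).
- move=> a x; rewrite /= /empty_coeff /=.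
  have -> : << x *g [::] >> = << [::] >> *~ x :> chain V.
    by rewrite freegU_mulz intz.
  by rewrite /nerve_map /= !raddfMz /= pushU alt_nil coeffU eqxx mulr1 intz.
Qed.

End NerveCriterion.

(** * Geodesics of CAT(0) spaces *)

Section ComparisonTriangle.
Variable R : realType.

Definition plane_point (a b : R) : 'rV[R]_2 := \row_i (if i == ord0 then a else b).

Lemma edist_plane a b c d :
  Defs.edist (plane_point a b) (plane_point c d) = Num.sqrt ((a - c) ^+ 2 + (b - d) ^+ 2).
Proof. by rewrite /Defs.edist big_ord_recl big_ord1 !mxE. Qed.

Lemma plane_point_comb (s t a b c d : R) :
  s *: plane_point a b + t *: plane_point c d =
  plane_point (s * a + t * c) (s * b + t * d).
Proof. by apply/rowP => i; rewrite !mxE; case: ifP. Qed.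

(** The third vertex of the plane triangle with vertices (0,0) and (D,0) and
    remaining sides of lengths [a] and [b]; the triangle inequalities say that
    its squared height is nonnegative. *)
Lemma third_vertex (D a b : R) : 0 < D -> 0 <= a -> 0 <= b ->
  D <= a + b -> a <= D + b -> b <= D + a ->
  exists u w, [/\ u ^+ 2 + w ^+ 2 = a ^+ 2, (D - u) ^+ 2 + w ^+ 2 = b ^+ 2 &
    2 * u * D = D ^+ 2 + a ^+ 2 - b ^+ 2].
Proof.
move=> D0 a0 b0 Dab aDb bDa.
pose u := (D ^+ 2 + a ^+ 2 - b ^+ 2) / (2 * D).
have uD : 2 * u * D = D ^+ 2 + a ^+ 2 - b ^+ 2.
  by rewrite /u; field; rewrite lt0r_neq0.
have w0 : 0 <= a ^+ 2 - u ^+ 2.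
  have ua : u <= a.
    rewrite -(ler_pM2r D0) -(ler_pM2l (ltr0Sn R 1)) mulrA uD.
    have : 0 <= (b - (D - a)) * (b + (D - a)) by apply: mulr_ge0; lra.
    lra.
  have ua' : - a <= u.
    rewrite -(ler_pM2r D0) -(ler_pM2l (ltr0Sn R 1)) mulrA [X in _ <= X]mulrA uD.
    have : 0 <= ((D + a) - b) * ((D + a) + b) by apply: mulr_ge0; lra.
    lra.
  rewrite subr_sqr; apply: mulr_ge0; lra.
exists u, (Num.sqrt (a ^+ 2 - u ^+ 2)); rewrite sqr_sqrtr //.
split=> //; first by rewrite addrC subrK.
have -> : (D - u) ^+ 2 = D ^+ 2 - 2 * u * D + u ^+ 2 by ring.
by rewrite uD; ring.
Qed.

End ComparisonTriangle.

Section Geometry.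
Variables (R : realType) (X : metricType R).
Hypothesis CX : CAT0 X.
Implicit Types x y z p q : X.

Definition geopt x y (t : R) : X := sval (cid (CX.1 x y)) (t * mdist x y).

Lemma geopt_geodesic x y : geodesic x y (sval (cid (CX.1 x y))).
Proof. by case: cid. Qed.

Lemma mul_seg (t D : R) : 0 <= D -> 0 <= t <= 1 -> t * D \in `[0, D].
Proof.
move=> D0 /andP[t0 t1]; rewrite in_itv /= mulr_ge0 //=.
by rewrite ler_piMl.
Qed.

Lemma mdist_geopt x y s t : 0 <= s <= 1 -> 0 <= t <= 1 ->
  mdist (geopt x y s) (geopt x y t) = `|s - t| * mdist x y.
Proof.
move=> s01 t01; have [_ _ ->] := geopt_geodesic x y; rewrite ?mul_seg ?mdist_ge0 //.
by rewrite -mulrBl normrM (ger0_norm (mdist_ge0 _ _)).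
Qed.

Lemma geopt0 x y : geopt x y 0 = x.
Proof. by rewrite /geopt mul0r; case: (geopt_geodesic x y). Qed.

Lemma geopt1 x y : geopt x y 1 = y.
Proof. by rewrite /geopt mul1r; case: (geopt_geodesic x y). Qed.

(** The comparison inequality between a vertex and a point of the opposite side,
    where the distance in the plane is given by Stewart's formula. *)
Lemma CN_inequality q x y t : 0 <= t <= 1 ->
  mdist q (geopt x y t) ^+ 2 <=
  (1 - t) * mdist q x ^+ 2 + t * mdist q y ^+ 2 - t * (1 - t) * mdist x y ^+ 2.
Proof.
move=> t01; have D0 := mdist_ge0 x y.
have [xy|xy] := eqVneq x y.
  rewrite -xy mdistxx; have -> : geopt x x t = x.
    by apply: mdist_positivity; rewrite -[X in mdist _ X](geopt0 x x) mdist_geopt ?lexx ?ler01 // mdistxx mulr0.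
  rewrite le_eqVlt; apply/orP; left; apply/eqP; ring.
have Dp : 0 < mdist x y by rewrite mdist_gt0.
have [u [w [uw Duw uD]]] := @third_vertex R (mdist x y) (mdist x q) (mdist y q)
  Dp (mdist_ge0 _ _) (mdist_ge0 _ _)
  ltac:(by rewrite (metric_sym y q); exact: metric_triangle)
  ltac:(exact: metric_triangle)
  ltac:(by rewrite (metric_sym x y); exact: metric_triangle).
pose v (i : 'I_3) := nth x [:: x; y; q] i.
pose c (i : 'I_3) := nth (fun=> x) [:: sval (cid (CX.1 x y));
  sval (cid (CX.1 y q)); sval (cid (CX.1 q x))] i.
pose p (i : 'I_3) := nth (plane_point 0 0)
  [:: plane_point 0 0; plane_point (mdist x y) 0; plane_point u w] i.
pose i0 : 'I_3 := @Ordinal 3 0 isT.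
pose i2 : 'I_3 := @Ordinal 3 2 isT.
have eD : (Num.sqrt ((0 - mdist x y) ^+ 2 + (0 - 0) ^+ 2)) = mdist x y :> R.
  by rewrite subr0 expr0n addr0 sub0r sqrrN sqrtr_sqr ger0_norm.
have ea : (Num.sqrt ((0 - u) ^+ 2 + (0 - w) ^+ 2)) = mdist x q :> R.
  by rewrite !sub0r !sqrrN uw sqrtr_sqr ger0_norm // mdist_ge0.
have eb : (Num.sqrt ((mdist x y - u) ^+ 2 + (0 - w) ^+ 2)) = mdist y q :> R.
  by rewrite !sub0r !sqrrN Duw sqrtr_sqr ger0_norm // mdist_ge0.
have eC (P Q : 'rV[R]_2) : Defs.edist P Q = Defs.edist Q P.
  by rewrite /Defs.edist; congr Num.sqrt; apply: eq_bigr => i _; rewrite -sqrrN opprB.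
have exx (P : 'rV[R]_2) : Defs.edist P P = 0.
  by rewrite /Defs.edist big1 ?sqrtr0 // => i _; rewrite subrr expr0n.
have vc i : geodesic (v i) (v (ordS i)) (c i).
  by case: i => -[|[|[|//]]] ?; exact: geopt_geodesic.
have pv i j : Defs.edist (p i) (p j) = mdist (v i) (v j).
  case: i => -[|[|[|//]]] ?; case: j => -[|[|[|//]]] ?; rewrite /p /v /=.
  - by rewrite exx mdistxx.
  - by rewrite edist_plane.
  - by rewrite edist_plane.
  - by rewrite eC (metric_sym y x) edist_plane.
  - by rewrite exx mdistxx.
  - by rewrite edist_plane.
  - by rewrite eC (metric_sym q x) edist_plane.
  - by rewrite eC (metric_sym q y) edist_plane.
  - by rewrite exx mdistxx.
have tD : t * mdist x y \in `[0, mdist x y] by exact: mul_seg.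
have q0 : 0 \in `[0, mdist q x] by rewrite in_itv /= lexx mdist_ge0.
have qE : c i2 0 = q by have [] := geopt_geodesic q x.
have := CX.2 v c p vc pv i0 i2 (t * mdist x y) 0 (plane_point (t * mdist x y) 0) (p i2)
  tD q0.
have cp0 : comparison_point (p i0) (p (ordS i0)) (plane_point (t * mdist x y) 0)
    (v i0) (c i0 (t * mdist x y)).
  split.
    exists t; first by rewrite in_itv.
    rewrite (_ : p i0 = plane_point 0 0) // (_ : p (ordS i0) = plane_point (mdist x y) 0) //.
    by rewrite plane_point_comb !mulr0 !add0r.
  rewrite (_ : p i0 = plane_point 0 0) // edist_plane.
  rewrite subr0 expr0n addr0 sub0r sqrrN sqrtr_sqr ger0_norm; last first.
    by move: tD; rewrite in_itv /= => /andP[].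
  have := @mdist_geopt x y 0 t; rewrite geopt0 => ->; rewrite ?lexx ?ler01 //.
  by rewrite sub0r normrN ger0_norm //; case/andP: t01.
have cp2 : comparison_point (p i2) (p (ordS i2)) (p i2) (v i2) (c i2 0).
  split; last by rewrite qE exx mdistxx.
  exists 0; first by rewrite in_itv /= lexx ler01.
  by rewrite scale0r addr0 subr0 scale1r.
move=> /(_ cp0 cp2).
rewrite qE (_ : c i0 (t * mdist x y) = geopt x y t) // (_ : p i2 = plane_point u w) //.
rewrite edist_plane metric_sym => le_d.
have E0 : 0 <= (t * mdist x y - u) ^+ 2 + (0 - w) ^+ 2 by rewrite addr_ge0 ?sqr_ge0.
apply: (@le_trans _ _ ((t * mdist x y - u) ^+ 2 + (0 - w) ^+ 2)).
  rewrite -[leRHS]sqr_sqrtr //; apply: lerXn2r => //; rewrite nnegrE ?mdist_ge0 ?sqrtr_ge0 //.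
rewrite (metric_sym q x) (metric_sym q y).
have -> : (t * mdist x y - u) ^+ 2 + (0 - w) ^+ 2 =
  t ^+ 2 * mdist x y ^+ 2 - t * (2 * u * mdist x y) + (u ^+ 2 + w ^+ 2) by ring.
rewrite uw uD le_eqVlt; apply/orP; left; apply/eqP; ring.
Qed.

(** The comparison inequality bounds the squared distance to [z] by 0. *)
Lemma geopt_unique x y z t : 0 <= t <= 1 ->
  mdist x z = t * mdist x y -> mdist z y = (1 - t) * mdist x y -> z = geopt x y t.
Proof.
move=> t01 xz zy; apply: mdist_positivity; apply/eqP; rewrite -sqrf_eq0.
rewrite eq_le sqr_ge0 andbT; apply: le_trans (CN_inequality z x y t01) _.
by rewrite (metric_sym z x) xz zy le_eqVlt; apply/orP; left; apply/eqP; ring.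
Qed.

(** The comparison inequality is used twice: for the side from [p] to [x] and the point
    at time [t] on the side from [p] to [y], then for this side and [x]. *)
Lemma geopt_contracts p x y t : 0 <= t <= 1 ->
  mdist (geopt p x t) (geopt p y t) <= t * mdist x y.
Proof.
move=> t01; have /andP[t0 t1] := t01.
have yp : mdist p (geopt p y t) = t * mdist p y.
  rewrite -[X in mdist X (geopt _ _ _)](geopt0 p y) mdist_geopt ?lexx ?ler01 // sub0r normrN ger0_norm //.
have h1 := CN_inequality (geopt p y t) p x t01.
have h2 := CN_inequality x p y t01.
rewrite -(@ler_pXn2r _ 2) ?nnegrE ?mulr_ge0 ?mdist_ge0 //.
rewrite metric_sym; apply: le_trans h1 _.
rewrite (metric_sym _ p) yp (metric_sym _ x).
have := ler_wpM2l t0 h2; rewrite (metric_sym x p) => h3.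
apply: (@le_trans _ _ ((1 - t) * (t * mdist p y) ^+ 2 +
  t * ((1 - t) * mdist p x ^+ 2 + t * mdist x y ^+ 2 - t * (1 - t) * mdist p y ^+ 2)
  - t * (1 - t) * mdist p x ^+ 2)); first by lra.
by rewrite le_eqVlt; apply/orP; left; apply/eqP; ring.
Qed.

Lemma mdist_geopt_le q x y t r : 0 <= t <= 1 ->
  mdist q x <= r -> mdist q y <= r -> mdist q (geopt x y t) <= r.
Proof.
move=> t01 qx qy; have /andP[t0 t1] := t01.
have r0 : 0 <= r by apply: le_trans qx; exact: mdist_ge0.
rewrite -(@ler_pXn2r _ 2) ?nnegrE ?mdist_ge0 //.
apply: le_trans (CN_inequality q x y t01) _.
have qx2 : mdist q x ^+ 2 <= r ^+ 2 by rewrite ler_pXn2r ?nnegrE ?mdist_ge0.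
have qy2 : mdist q y ^+ 2 <= r ^+ 2 by rewrite ler_pXn2r ?nnegrE ?mdist_ge0.
have t1' : 0 <= 1 - t by lra.
have := ler_wpM2l t0 qy2; have := ler_wpM2l t1' qx2.
have : 0 <= t * (1 - t) * mdist x y ^+ 2 by apply: mulr_ge0; [exact: mulr_ge0|exact: sqr_ge0].
lra.
Qed.

Lemma mdist_geopt_lt q x y t r : 0 <= t <= 1 ->
  mdist q x < r -> mdist q y < r -> mdist q (geopt x y t) < r.
Proof.
move=> t01 qx qy; apply: (@le_lt_trans _ _ (Num.max (mdist q x) (mdist q y))).
  by apply: mdist_geopt_le => //; rewrite le_max lexx ?orbT.
by rewrite gt_max qx qy.
Qed.

Lemma isometry_geopt (f : X -> X) x y t :
  (forall x y, mdist (f x) (f y) = mdist x y) -> 0 <= t <= 1 ->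
  f (geopt x y t) = geopt (f x) (f y) t.
Proof.
move=> fP t01; have /andP[t0 t1] := t01.
apply: geopt_unique; rewrite ?fP //.
  by rewrite -[X in mdist X (geopt _ _ _)](geopt0 x y) mdist_geopt ?lexx ?ler01 // sub0r normrN ger0_norm.
rewrite -[X in mdist (geopt _ _ _) X](geopt1 x y) mdist_geopt ?lexx ?ler01 //.
by rewrite distrC ger0_norm // subr_ge0.
Qed.

End Geometry.

(** * Geodesic subdivision of tuples *)

Section Subdivision.
Variables (V : choiceType) (N : nat) (flow : V -> nat -> V -> V).
Hypothesis flow0 : forall p x, flow p 0 x = p.
Hypothesis flowN : forall p x, flow p N x = x.
Implicit Types (x y p : V) (s t : seq V) (c : chain V).

(** The track of a chain under the geodesic contraction to [p], cut into [N]
    prisms, together with a cone over its final position. *)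
Definition fill p c : chain V :=
  \sum_(0 <= i < N) prism (flow p i) (flow p i.+1) c + cone p (push (flow p 0) c).

Lemma fill_is_additive p : zmod_morphism (fill p).
Proof.
move=> c d; rewrite /fill opprD addrACA -sumrB; congr (_ + _).
  by apply: eq_bigr => i _; rewrite raddfB.
by rewrite !raddfB.
Qed.
HB.instance Definition _ p :=
  GRing.isZmodMorphism.Build (chain V) (chain V) (fill p) (fill_is_additive p).

(** The boundaries of the prisms telescope from the final position of [c], which the
    cone fills, to [c]. *)
Lemma bd_fill p c : bd c = 0 -> bd (fill p c) = c.
Proof.
move=> c0; rewrite /fill raddfD raddf_sum /= bd_cone -push_bd c0 !raddf0 addr0.
under eq_bigr => i _.
  have := prism_homotopy (flow p i) (flow p i.+1) c.
  rewrite c0 raddf0 addr0 => ->; over.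
rewrite (telescope_sumr (fun i => push (flow p i) c)) // subrK.
rewrite (eq_push (g := id)); last by move=> x; rewrite flowN.
apply: (@freeg_additive_eq _ _ (push id) idfun) => s /=.
by rewrite pushU map_id.
Qed.

Definition sub_step (f : chain V -> chain V) : chain V -> chain V :=
  zlift (fun s => if s is x :: _ then fill x (f (bd << s >>)) else 0).
HB.instance Definition _ f := GRing.Additive.on (sub_step f).

(** Subdivision of the tuples of size [k]: a tuple is replaced by a filling of
    its subdivided boundary. *)
Fixpoint sub (k : nat) : chain V -> chain V :=
  if k is j.+1 then sub_step (sub j) else idfun.

Lemma sub_is_additive k : zmod_morphism (sub k).
Proof. by case: k => [|k] c d //=; rewrite raddfB. Qed.
HB.instance Definition _ k :=
  GRing.isZmodMorphism.Build (chain V) (chain V) (sub k) (sub_is_additive k).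

Lemma sub_consU k x s : sub k.+1 << x :: s >> = fill x (sub k (bd << x :: s >>)).
Proof. exact: zliftU. Qed.

Definition of_size k := [set s : seq V | size s = k].

Lemma of_size_bd k c : supported (of_size k.+1) c -> supported (of_size k) (bd c).
Proof. by apply: supp_bd => s t sk _; rewrite sk => -[]. Qed.

Lemma bd_sub k c : supported (of_size k.+1) c -> bd (sub k.+1 c) = sub k (bd c).
Proof.
elim: k c => [|k IHk] c.
  move=> ck; apply: (eq_on_supp (f := @bd V \o sub 1) (g := @bd V) _ ck) => -[//|x s] _.
  by rewrite -[LHS]/(bd (sub 1 << x :: s >>)) sub_consU bd_fill //= bd_bd.
move=> ck; apply: (eq_on_supp (f := @bd V \o sub k.+2) (g := sub k.+1 \o @bd V) _ ck).
move=> [//|x s] xs.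
rewrite -[LHS]/(bd (sub k.+2 << x :: s >>)) -[RHS]/(sub k.+1 (bd << x :: s >>)).
rewrite sub_consU bd_fill // IHk ?bd_bd ?raddf0 //.
by apply: of_size_bd; exact: suppU.
Qed.

Definition homotopy_step (f g : chain V -> chain V) : chain V -> chain V :=
  zlift (fun s => if s is x :: _
                  then cone x (<< s >> - f << s >> - g (bd << s >>)) else 0).
HB.instance Definition _ f g := GRing.Additive.on (homotopy_step f g).

(** The homotopy between a tuple and its subdivision is the cone from the first entry,
    so that it stays in every convex set that contains the tuple. *)
Fixpoint sub_homotopy (k : nat) : chain V -> chain V :=
  if k is j.+1 then homotopy_step (sub j.+1) (sub_homotopy j) else \0.

Lemma sub_homotopy_is_additive k : zmod_morphism (sub_homotopy k).
Proof. by case: k => [|k] c d /=; rewrite ?subr0 // raddfB. Qed.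
HB.instance Definition _ k := GRing.isZmodMorphism.Build
  (chain V) (chain V) (sub_homotopy k) (sub_homotopy_is_additive k).

Lemma sub_homotopy_consU k x s : sub_homotopy k.+1 << x :: s >> =
  cone x (<< x :: s >> - sub k.+1 << x :: s >> - sub_homotopy k (bd << x :: s >>)).
Proof. exact: zliftU. Qed.

Lemma bd_sub_homotopyS k c : supported (of_size k.+1) c ->
  bd (sub_homotopy k.+1 c) = c - sub k.+1 c - sub_homotopy k (bd c).
Proof.
have bdBB (a b d : chain V) : bd (a - b - d) = bd a - bd b - bd d by rewrite !raddfB.
elim: k c => [|k IHk] c.
  move=> ck; apply: (eq_on_supp (f := @bd V \o sub_homotopy 1)
    (g := (idfun \- sub 1) \- (\0 \o @bd V)) _ ck) => -[//|x s] xs.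
  rewrite -[LHS]/(bd (sub_homotopy 1 << x :: s >>)).
  rewrite -[RHS]/(<< x :: s >> - sub 1 << x :: s >> - 0).
  rewrite sub_homotopy_consU bd_cone bdBB bd_sub; last exact: suppU.
  by rewrite [sub_homotopy 0 _](_ : _ = 0) // subrr !raddf0 !addr0 raddf0 oppr0 addr0.
move=> ck; apply: (eq_on_supp (f := @bd V \o sub_homotopy k.+2)
  (g := (idfun \- sub k.+2) \- (sub_homotopy k.+1 \o @bd V)) _ ck) => -[//|x s] xs.
rewrite -[LHS]/(bd (sub_homotopy k.+2 << x :: s >>)).
rewrite -[RHS]/(<< x :: s >> - sub k.+2 << x :: s >> - sub_homotopy k.+1 (bd << x :: s >>)).
rewrite sub_homotopy_consU bd_cone bdBB bd_sub; last exact: suppU.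
rewrite IHk; last by apply: of_size_bd; exact: suppU.
by rewrite bd_bd raddf0 subr0 subrr raddf0 subr0.
Qed.

Lemma bd_sub_homotopy k c : supported (of_size k) c -> bd c = 0 ->
  bd (sub_homotopy k c) = c - sub k c.
Proof.
case: k => [|k] ck c0; first by rewrite /= raddf0 subrr.
by rewrite bd_sub_homotopyS // c0 raddf0 subr0.
Qed.

Lemma supp_prism (W : choiceType) (f g : V -> W) s : supported
  [set t : seq W | size t = (size s).+1 /\
           forall y : W, y \in t -> exists2 x, x \in s & y = f x \/ y = g x]
  (prism f g << s >>).
Proof.
elim: s => [|x s IHs]; first by rewrite prism_nil; exact: supp0.
rewrite -coneU prism_cone; apply: suppB.
  rewrite pushU !coneU; apply: suppU; split; first by rewrite /= size_map.
  move=> y; rewrite !inE => /or3P[/eqP->|/eqP->|/mapP[z zs ->]].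
  - by exists x; [rewrite mem_head|left].
  - by exists x; [rewrite mem_head|right].
  - by exists z; [rewrite inE zs orbT|right].
apply: supp_cone IHs => t [st tP]; split=> [|y]; first by rewrite /= st.
rewrite inE => /predU1P[->|/tP[z zs yz]]; first by exists x; [rewrite mem_head|left].
by exists z => //; rewrite inE zs orbT.
Qed.

Lemma supp_fill p (A B : set (seq V)) c :
  (forall s t, A s -> size t = (size s).+1 -> (forall y, y \in t -> y = p) -> B t) ->
  (forall s t i, A s -> size t = (size s).+1 -> (i < N)%N ->
    (forall y, y \in t ->
       exists2 x, x \in s & y = flow p i x \/ y = flow p i.+1 x) -> B t) ->
  supported A c -> supported B (fill p c).
Proof.
move=> Bp Bflow; apply: supp_map => s As /=; rewrite /fill; apply: suppD.
  rewrite big_nat; apply: (big_ind (supported B)); [exact: supp0|exact: suppD|].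
  move=> i /andP[_ iN]; apply: sub_supp (supp_prism (s := s)) => t [st tP].
  exact: Bflow As st iN tP.
rewrite pushU coneU; apply: suppU; apply: Bp As _ _; first by rewrite /= size_map.
by move=> y; rewrite inE => /predU1P[//|/mapP[z _ ->]]; rewrite flow0.
Qed.

End Subdivision.

Section Fineness.
Variables (R : realType) (X : metricType R).
Hypothesis CX : CAT0 X.
Implicit Types (x y p : X) (s t : seq X) (c : chain X).
Local Notation geopt := (geopt CX).

Definition geodesically_convex (B : set X) : Prop :=
  forall x y (t : R), B x -> B y -> 0 <= t <= 1 -> B (geopt x y t).

Definition inside (B : set X) : set (seq X) := [set s : seq X | forall x, x \in s -> B x].

Definition diam_le (r : R) : set (seq X) :=
  [set s : seq X | forall x y, x \in s -> y \in s -> mdist x y <= r].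

Section Flow.
Variable N : nat.
Hypothesis N_gt0 : (0 < N)%N.

Definition flow p (i : nat) x : X := geopt p x (i%:R / N%:R).

Let NR : (N%:R : R) != 0. Proof. by rewrite pnatr_eq0 -lt0n. Qed.

Lemma flow0 p x : flow p 0 x = p.
Proof. by rewrite /flow mul0r geopt0. Qed.

Lemma flowN p x : flow p N x = x.
Proof. by rewrite /flow divff // geopt1. Qed.

Lemma flow_time i : (i <= N)%N -> 0 <= (i%:R / N%:R : R) <= 1.
Proof.
by move=> iN; rewrite divr_ge0 //= ler_pdivrMr ?ltr0n // mul1r ler_nat.
Qed.

Section Bounds.
Variables (l : seq X) (B : set X) (D : R).
Hypothesis B_convex : geodesically_convex B.
Hypothesis B_diam : forall x y, B x -> B y -> mdist x y <= D.
Hypothesis lB : inside B l.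

(** The vertices of the subdivided tuples of size [k] belong to this set, whatever
    the number [N] of time steps. *)
Fixpoint reach (k : nat) : set X :=
  if k is j.+1 then [set y | exists x z (t : R),
    [/\ x \in l, reach j z, 0 <= t <= 1 & y = geopt x z t]]
  else [set` l].

Lemma reach_sub k : reach k `<=` B.
Proof.
elim: k => [|k IHk] y /=; first exact: lB.
by move=> [x [z [t [xl /IHk Bz t01 ->]]]]; apply: B_convex => //; exact: lB.
Qed.

Lemma reach_base k x : x \in l -> reach k x.
Proof.
elim: k => [//|k IHk] xl; exists x, x, 1; rewrite geopt1.
by split; rewrite ?ler01 ?lexx //; exact: IHk.
Qed.

(** The contraction does not increase distances, so one filling adds at most the length
    [D / N] of a time step to the mesh. *)
Lemma supp_sub k c : supported (of_size k `&` [set s : seq X | {subset s <= l}]) c ->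
  supported (of_size k `&` inside (reach k) `&` diam_le (k%:R * (D / N%:R))) (sub N flow k c).
Proof.
elim: k c => [|k IHk] c.
  apply: sub_supp => s [s0 _]; have -> : s = [::] by exact: size0nil.
  by split.
apply: supp_map => -[[//]|x s] [xs sl].
rewrite -[X in supported _ X]/(sub N flow k.+1 << x :: s >>) sub_consU.
have xl : x \in l by apply: sl; exact: mem_head.
have D0 : 0 <= D by apply: le_trans (B_diam (lB xl) (lB xl)); rewrite mdistxx.
have DN : 0 <= D / N%:R by rewrite divr_ge0.
apply: (supp_fill flow0
  (A := of_size k `&` inside (reach k) `&` diam_le (k%:R * (D / N%:R))) _ _ (IHk _ _)).
- move=> t u [[tk _] _] ut ux; split; first split.
  + by rewrite /of_size /= ut tk.
  + by move=> y /ux ->; exact: reach_base.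
  + move=> y z /ux -> /ux ->; rewrite mdistxx; exact: mulr_ge0.
- move=> t u i [[tk tr] tf] ut iN uP; split; first split.
  + by rewrite /of_size /= ut tk.
  + move=> y /uP[z zt [->|->]].
      exists x, z, (i%:R / N%:R); split=> //; first exact: tr.
      by apply: flow_time; exact: ltnW.
    exists x, z, (i.+1%:R / N%:R); split=> //; first exact: tr.
    exact: flow_time.
  + have close y : y \in u -> exists2 z, z \in t &
        mdist y (flow x i z) <= D / N%:R /\ mdist y (flow x i.+1 z) <= D / N%:R.
      move=> /uP[z zt yz]; exists z => //.
      have Dxz : mdist x z <= D.
        by apply: B_diam; [exact: lB|apply: reach_sub (tr _ zt)].
      have step : mdist (flow x i z) (flow x i.+1 z) <= D / N%:R.
        rewrite mdist_geopt ?flow_time // 1?ltnW // -mulrBl.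
        rewrite -natr1 opprD addrA subrr sub0r mulN1r normrN.
        rewrite ger0_norm ?invr_ge0 // mulrC; exact: ler_wpM2r.
      by case: yz => ->; rewrite ?mdistxx; split=> //; rewrite metric_sym.
    have zz' j z z' : (j <= N)%N -> z \in t -> z' \in t -> mdist (flow x j z) (flow x j z') <= k%:R * (D / N%:R).
      move=> jN zt zt'; apply: le_trans (tf _ _ zt zt').
      have /andP[j0 j1] := flow_time jN.
      apply: le_trans (geopt_contracts CX _ _ _ (flow_time jN)) _.
      by apply: ler_piMl => //; exact: mdist_ge0.
    move=> y y' /close[z zt [yz yz1]] /uP[z' zt' y'z'].
    rewrite -natr1 mulrDl mul1r addrC.
    case: y'z' => ->; [apply: le_trans (metric_triangle _ (flow x i z) _) _
                      |apply: le_trans (metric_triangle _ (flow x i.+1 z) _) _];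
      apply: lerD => //; apply: zz' => //; exact: ltnW.
- apply: (@supp_bd _ [set x :: s]); last exact: suppU.
  move=> _ t -> ts st; split; first by move: st; rewrite xs => -[].
  by move=> y /(mem_subseq ts); exact: sl.
Qed.

End Bounds.
End Flow.
End Fineness.

(** * Acyclicity of the complex of small tuples *)

Section Acyclicity.
Variables (R : realType) (X : metricType R).
Hypothesis CX : CAT0 X.
Implicit Types (x y p : X) (s t : seq X) (c : chain X).
Local Notation geopt := (geopt CX).
Local Notation geodesically_convex := (geodesically_convex CX).

Section Inside.
Variables (N : nat) (B : set X).
Hypothesis N_gt0 : (0 < N)%N.
Hypothesis B_convex : geodesically_convex B.

Lemma supp_sub_inside k c : supported (of_size k `&` inside B) c ->
  supported (of_size k `&` inside B) (sub N (flow CX N) k c).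
Proof.
elim: k c => [//|k IHk] c; apply: supp_map => -[[//]|x s] [xs sB].
rewrite -[X in supported _ X]/(sub N (flow CX N) k.+1 << x :: s >>) sub_consU.
have xB : B x by apply: sB; exact: mem_head.
apply: (supp_fill (flow0 CX N) (A := of_size k `&` inside B) _ _ (IHk _ _)).
- move=> t u [tk tB] ut ux; split; first by rewrite /of_size /= ut tk.
  by move=> y /ux ->.
- move=> t u i [tk tB] ut iN uP; split; first by rewrite /of_size /= ut tk.
  move=> y /uP[z zt [->|->]]; apply: B_convex => //; try exact: tB.
    by apply: flow_time => //; exact: ltnW.
  exact: flow_time.
- apply: (@supp_bd _ [set x :: s]); last exact: suppU.
  move=> _ t -> ts st; split; first by move: st; rewrite xs => -[].
  by move=> y /(mem_subseq ts); exact: sB.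
Qed.

Lemma supp_sub_homotopy_inside k c : supported (of_size k `&` inside B) c ->
  supported (of_size k.+1 `&` inside B) (sub_homotopy N (flow CX N) k c).
Proof.
elim: k c => [|k IHk] c; first by move=> _; exact: supp0.
apply: supp_map => -[[//]|x s] [xs sB].
rewrite -[X in supported _ X]/(sub_homotopy N (flow CX N) k.+1 << x :: s >>).
rewrite sub_homotopy_consU; apply: (@supp_cone _ (of_size k.+1 `&` inside B)).
  move=> t [tk tB]; split; first by rewrite /of_size /= tk.
  by move=> y; rewrite inE => /predU1P[->|/tB//]; apply: sB; exact: mem_head.
have xsU : supported (of_size k.+1 `&` inside B) << x :: s >> by exact: suppU.
apply: suppB; first by apply: suppB => //; exact: supp_sub_inside.
apply: IHk; apply: (@supp_bd _ [set x :: s]); last exact: suppU.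
move=> _ t -> ts st; split; first by move: st; rewrite xs => -[].
by move=> y /(mem_subseq ts); exact: sB.
Qed.

End Inside.

(** Clamping the time extends the contraction from [0, 1] to a continuous map on
    all of R * X. *)
Definition clamp (t : R) : R := Num.max 0 (Num.min 1 t).

Lemma clamp01 (t : R) : 0 <= clamp t <= 1.
Proof. by rewrite /clamp le_max lexx /= ge_max ler01 ge_min lexx. Qed.

Lemma clamp_id (t : R) : 0 <= t <= 1 -> clamp t = t.
Proof. by move=> /andP[t0 t1]; rewrite /clamp min_r // max_r. Qed.

Lemma clamp_lip (s t : R) : `|clamp s - clamp t| <= `|s - t|.
Proof.
rewrite /clamp /Num.max /Num.min.
by do ![case: ifPn => //]; rewrite ?ltNge ?ler_norml => *;
  have := ler_norm (s - t); have := ler_norm (t - s); rewrite distrC => *; lra.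
Qed.

Lemma geopt_continuous x : continuous (fun tz : R * X => geopt x tz.2 (clamp tz.1)).
Proof.
move=> -[t z] /=.
apply/metricType_numDomainType.cvgrPdist_lt => e e0.
have d0 : 0 < mdist x z + 1 by rewrite ltr_wpDl ?mdist_ge0.
have e1 : 0 < e / 2 / (mdist x z + 1) by rewrite !divr_gt0.
have e2 : 0 < e / 2 by rewrite divr_gt0.
exists (ball t (e / 2 / (mdist x z + 1)), ball z (e / 2)).
  by split; exact: nbhsx_ballx.
move=> -[t' z'] [/= tt' zz'].
apply: le_lt_trans (metric_triangle _ (geopt x z (clamp t')) _) _.
rewrite (splitr e); apply: ltr_leD.
  rewrite mdist_geopt ?clamp01 //.
  apply: (@le_lt_trans _ _ (`|t - t'| * (mdist x z + 1))).
    apply: ler_pM => //; rewrite ?mdist_ge0 ?clamp_lip //.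
    by rewrite lerDl.
  by rewrite -ltr_pdivlMr.
apply: le_trans (geopt_contracts CX _ _ _ (clamp01 _)) _.
apply: (@le_trans _ _ (mdist z z')).
  by apply: ler_piMl; [exact: mdist_ge0|case/andP: (clamp01 t')].
by apply: ltW; move: zz'; rewrite ballEmdist.
Qed.

Lemma reach_compact (l : seq X) k : compact (reach CX l k).
Proof.
elim: k => [|k IHk] /=.
  by apply: finite_compact; exact: finite_seq.
have -> : [set y | exists x z (t : R), [/\ x \in l, reach CX l k z, 0 <= t <= 1 &
    y = geopt x z t]] =
    \bigcup_(x in [set` l]) ((fun tz : R * X => geopt x tz.2 (clamp tz.1)) @`
      (`[0, 1]%classic `*` reach CX l k)).
  apply/seteqP; split=> y.
    move=> [x [z [t [xl zk t01 ->]]]]; exists x => //; exists (t, z).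
      by split=> //=; rewrite in_itv.
    by rewrite /= clamp_id.
  move=> [x xl [[t z] [/= t01 zk] <-]]; exists x, z, (clamp t).
  by split=> //; exact: clamp01.
rewrite bigcup_seq; apply: bigsetU_compact => x _.
apply: continuous_compact.
  by apply: continuous_subspaceT; exact: geopt_continuous.
by apply: compact_setX => //; exact: segment_compact.
Qed.

Variable e : X -> R.
Hypothesis e_gt0 : forall x, 0 < e x.
Hypothesis e_lip : forall x y, e x <= e y + mdist x y.

Lemma lip_continuous : continuous e.
Proof.
move=> x; apply/cvgrPdist_lt => r r0; near=> y.
have xy : mdist x y < r.
  have : ball x r y by near: y; exact: nbhsx_ballx.
  by rewrite ballEmdist.
have := e_lip x y; have := e_lip y x; rewrite (metric_sym y x) ltr_norml.
by move=> *; apply/andP; split; lra.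
Unshelve. all: by end_near. Qed.

Definition small : set (seq X) :=
  [set s : seq X | exists q, forall x, x \in s -> mdist q x < e q].

(** The tuples of a convex set that lie in small balls form an acyclic complex. A
    cycle [z] bounds the cone [p.z], whose subdivision has small tuples for [N]
    large, because the vertices of all subdivisions stay in one compact set, on
    which [e] has a positive minimum. The homotopy from [z] to its subdivision
    stays in the convex balls that contain the tuples of [z]. *)
Lemma small_acyclic (B : set X) p k z : geodesically_convex B -> B p ->
  supported (of_size k `&` small `&` inside B) z -> bd z = 0 ->
  exists2 w, supported (of_size k.+1 `&` small `&` inside B) w & bd w = z.
Proof.
move=> Bconv Bp zP z0.
pose l := p :: flatten (dom z).
have lB : inside B l.
  move=> x; rewrite inE => /predU1P[->//|/flattenP[s]].
  by rewrite mem_dom => /zP[_]; apply.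
have [D0 D0P] : exists D0, forall x, x \in l -> mdist p x <= D0.
  elim: (l) => [|y l' [D1 D1P]]; first by exists 0.
  exists (Num.max (mdist p y) D1) => x; rewrite inE => /predU1P[->|/D1P xD1].
    by rewrite le_max lexx.
  by rewrite le_max xD1 orbT.
pose B' := B `&` [set x | mdist p x <= D0].
have B'conv : geodesically_convex B'.
  move=> x y t [Bx px] [By py] t01; split; first exact: Bconv.
  exact: mdist_geopt_le.
have lB' : inside B' l by move=> x xl; split; [exact: lB|exact: D0P].
have B'diam x y : B' x -> B' y -> mdist x y <= D0 + D0.
  move=> [_ px] [_ py]; apply: le_trans (metric_triangle _ p _) _.
  by rewrite (metric_sym x p); exact: lerD.
have [y0 _ y0P] : exists2 y0, y0 \in reach CX l k.+1 &
    forall y, y \in reach CX l k.+1 -> e y0 <= e y.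
  apply: compact_EVT_min; [|exact: reach_compact|].
    by exists p; apply: reach_base; exact: mem_head.
  by apply: continuous_subspaceT; exact: lip_continuous.
have [N N0 kN] : exists2 N, (0 < N)%N & k.+1%:R * ((D0 + D0) / N%:R) < e y0.
  exists (Num.truncn (k.+1%:R * (D0 + D0) / e y0)).+1 => //.
  have := truncnS_gt (k.+1%:R * (D0 + D0) / e y0).
  by rewrite ltr_pdivrMr // mulrA ltr_pdivrMr ?ltr0n // [X in _ -> _ < X]mulrC.
exists (sub N (flow CX N) k.+1 (cone p z) + sub_homotopy N (flow CX N) k z); last first.
  have zk : supported (of_size k) z by apply: sub_supp zP => s [[]].
  have pzk : supported (of_size k.+1) (cone p z).
    by apply: supp_cone zk => s; rewrite /of_size /= => ->.
  rewrite raddfD /= -[X in bd X + _]/(sub N (flow CX N) k.+1 (cone p z)).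
  rewrite (bd_sub (flowN CX N0)) // bd_cone z0 raddf0 subr0.
  rewrite (bd_sub_homotopy (flowN CX N0)) //.
  by rewrite addrC subrK.
apply: suppD.
  have pzl : supported (of_size k.+1 `&` [set s : seq X | {subset s <= l}]) (cone p z).
    apply: (@supp_cone _ [set` dom z]) => [s /= sz|s]; last by rewrite /= mem_dom.
    have [[sk _] _] : (of_size k `&` small `&` inside B) s by apply: zP; rewrite -mem_dom.
    split; first by rewrite /of_size /= sk.
    move=> x; rewrite inE => /predU1P[->|xs]; first exact: mem_head.
    by rewrite inE; apply/orP; right; apply/flattenP; exists s.
  have subP := supp_sub N0 B'conv B'diam lB' pzl.
  apply: sub_supp subP => s [[sk sr] sf].
  split; first split=> //; last first.
    by move=> x /sr /(reach_sub B'conv lB') [].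
  case: s sk sr sf => [//|y s] _ sr sf; exists y => x xs.
  apply: le_lt_trans (sf _ _ (mem_head _ _) xs) _; apply: lt_le_trans kN _.
  by apply: y0P; rewrite inE; apply: sr; exact: mem_head.
apply: supp_map zP => s [[sk [q sq]] sB].
pose B'' := B `&` [set x | mdist q x < e q].
have B''conv : geodesically_convex B''.
  move=> x y t [Bx px] [By py] t01; split; first exact: Bconv.
  exact: mdist_geopt_lt.
apply: sub_supp (supp_sub_homotopy_inside N0 B''conv (suppU _)) => [t [tk tB]|].
  split; [split=> //; exists q => x /tB[]//|by move=> x /tB[]].
by split=> // x xs; split; [exact: sB|exact: sq].
Qed.



End Acyclicity.

(** * Invariant covers *)

Section Lebesgue.
Variables (R : realType) (X : metricType R).
Implicit Types (x y z : X) (A B : set X).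

Lemma metric_openP A :
  open A <-> forall x, A x -> exists2 r : R, 0 < r & forall y, mdist x y < r -> A y.
Proof.
rewrite openE; split=> [Ao x /Ao|Ao x /Ao].
  rewrite /interior -nbhs_ballE => -[r /= r0 rA]; exists r => // y xy.
  by apply: rA; rewrite ballEmdist.
move=> [r r0 rA]; rewrite /interior -nbhs_ballE; exists r => // y.
by rewrite ballEmdist; exact: rA.
Qed.

Lemma metric_closedP A : closed A <->
  forall x, (forall r : R, 0 < r -> exists2 y, A y & mdist x y < r) -> A x.
Proof.
rewrite -openC metric_openP; split=> [Ao x xA|Ao x nAx].
  apply: contrapT => /Ao[r r0 rA]; have [y Ay xy] := xA r r0.
  exact: rA xy Ay.
apply: contrapT => nr; apply: nAx; apply: Ao => r r0.
apply: contrapT => ny; apply: nr; exists r => // y xy Ay.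
by apply: ny; exists y.
Qed.

Variable I : Type.
Implicit Type U : I -> set X.

Definition leb_set U x : set R :=
  [set r | r = 0 \/ 0 <= r <= 1 /\ exists i, forall y, mdist x y < r -> U i y].

(** The Lebesgue function of a family of sets: the radius, up to the bound 1, of
    the largest ball around a point that one member of the family contains. *)
Definition lebesgue_radius U x : R := sup (leb_set U x).

Lemma leb_set_sup U x : has_sup (leb_set U x).
Proof.
split; first by exists 0; left.
by exists 1 => r [->//|[/andP[]]].
Qed.

Lemma leb_ub U x r i : 0 <= r <= 1 -> (forall y, mdist x y < r -> U i y) ->
  r <= lebesgue_radius U x.
Proof.
move=> r01 rU; apply: sup_upper_bound; first exact: leb_set_sup.
by right; split=> //; exists i.
Qed.

Lemma leb_ge0 U x : 0 <= lebesgue_radius U x.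
Proof. by apply: sup_upper_bound; [exact: leb_set_sup|left]. Qed.

Lemma leb_adherent U x r : 0 <= r -> r < lebesgue_radius U x -> exists r' i,
  [/\ r < r', r' <= 1 & forall y, mdist x y < r' -> U i y].
Proof.
move=> r0 rU; have d0 : 0 < lebesgue_radius U x - r by rewrite subr_gt0.
have [r' [->|[/andP[_ r'1] [i iU]]]] := sup_adherent d0 (leb_set_sup U x).
  by rewrite subKr ltNge r0.
by rewrite subKr => rr'; exists r', i.
Qed.

Lemma leb_gt0_mem U x : 0 < lebesgue_radius U x -> exists i, U i x.
Proof.
move=> /(leb_adherent (lexx 0))[r [i [r0 _ rU]]]; exists i.
by apply: rU; rewrite mdistxx.
Qed.

Lemma leb_gt0 U x i : open (U i) -> U i x -> 0 < lebesgue_radius U x.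
Proof.
move=> /metric_openP Uo /Uo[r r0 rU]; apply: (@lt_le_trans _ _ (Num.min r 1)).
  by rewrite lt_min r0 ltr01.
apply: (@leb_ub _ _ _ i); first by rewrite le_min (ltW r0) ler01 ge_min lexx orbT.
by move=> y; rewrite lt_min => /andP[/rU].
Qed.

Lemma leb_lip U x y : lebesgue_radius U x <= lebesgue_radius U y + mdist x y.
Proof.
apply: ge_sup; first by exists 0; left.
move=> r [->|[/andP[r0 r1] [i iU]]]; first by rewrite addr_ge0 ?leb_ge0 ?mdist_ge0.
have [rd|dr] := leP r (mdist x y); first by rewrite (le_trans rd) // lerDr leb_ge0.
rewrite -lerBlDr; apply: (@leb_ub _ _ _ i).
  rewrite subr_ge0 (ltW dr) /= lerBlDr (le_trans r1) // lerDl; exact: mdist_ge0.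
move=> z yz; apply: iU; apply: le_lt_trans (metric_triangle _ y _) _.
by rewrite -ltrBrDl.
Qed.

Lemma leb_map (f : X -> X) U x :
  (forall y z, mdist (f y) (f z) = mdist y z) -> (forall z, exists y, f y = z) ->
  (forall i, exists j, forall y, U i y -> U j (f y)) -> lebesgue_radius U x <= lebesgue_radius U (f x).
Proof.
move=> fiso fsurj fU; apply: ge_sup; first by exists 0; left.
move=> r [->|[r01 [i iU]]]; first exact: leb_ge0.
have [j jU] := fU i; apply: (@leb_ub _ _ _ j) => // z.
by have [y <-] := fsurj z; rewrite fiso => xy; apply/jU/iU.
Qed.

End Lebesgue.

Section InvariantCovers.
Variables (R : realType) (G : groupType) (X : metricType R) (act : G -> X -> X).
Hypothesis actP : action_law act.
Hypothesis act_iso : isometric_action act.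
Implicit Types (x y z : X) (U W : nat -> set X) (E : set X).

Definition act_stable (A : set X) : Prop := forall g x, A x -> A (act g x).

Lemma actK g x : act g^-1%g (act g x) = x.
Proof. by rewrite -actP.2 mulVg actP.1. Qed.

Lemma actVK g x : act g (act g^-1%g x) = x.
Proof. by rewrite -actP.2 mulgV actP.1. Qed.

Lemma mdist_actl g x y : mdist (act g x) y = mdist x (act g^-1%g y).
Proof. by rewrite -{1}(actVK g y) act_iso. Qed.

Lemma leb_act (I : Type) (V : I -> set X) :
  (forall g i, exists j, forall y, V i y -> V j (act g y)) ->
  forall g x, lebesgue_radius V (act g x) = lebesgue_radius V x.
Proof.
move=> Vact g x; apply/eqP; rewrite eq_le; apply/andP; split.
  rewrite -{2}(actK g x); apply: (leb_map (f := act g^-1%g)).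
  - by move=> y z; rewrite act_iso.
  - by move=> z; exists (act g z); exact: actK.
  - exact: Vact.
apply: (leb_map (f := act g)).
- by move=> y z; rewrite act_iso.
- by move=> z; exists (act g^-1%g z); exact: actVK.
- exact: Vact.
Qed.

Record invariant_cover U : Prop := InvariantCover {
  ic_open : forall j, open (U j);
  ic_inv : forall j, act_stable (U j);
  ic_cover : forall x, exists j, U j x }.

Definition single (A : set X) : unit -> set X := fun=> A.

Lemma leb_cover_act U : (forall j, act_stable (U j)) ->
  forall g x, lebesgue_radius U (act g x) = lebesgue_radius U x.
Proof. by move=> Uinv; apply: leb_act => g j; exists j => y; exact: Uinv. Qed.

Lemma leb_single_act (A : set X) : act_stable A ->
  forall g x, lebesgue_radius (single A) (act g x) = lebesgue_radius (single A) x.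
Proof. by move=> Ainv; apply: leb_act => g j; exists j => y; exact: Ainv. Qed.

(** The points where the largest ball in the member has more than half the radius
    of the largest ball in any member are kept; allowing equality makes the
    condition closed. *)
Lemma invariant_shrinking W : invariant_cover W -> exists U' K : nat -> set X,
  [/\ invariant_cover U', forall j, closed (K j), forall j, act_stable (K j),
      forall j, U' j `<=` K j & forall j, K j `<=` W j].
Proof.
move=> [Wo Winv Wc].
pose s := lebesgue_radius W; pose g j := lebesgue_radius (single (W j)).
have s_act := leb_cover_act Winv; have g_act j := leb_single_act (Winv j).
have s_gt0 x : 0 < s x by have [j xj] := Wc x; exact: leb_gt0 (Wo j) xj.
have s_lip x y := leb_lip W x y; have g_lip j x y := leb_lip (single (W j)) x y.
exists (fun j => [set x | s x < 2 * g j x]), (fun j => [set x | s x <= 2 * g j x]).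
split.
- split=> [j|j h x|x].
  + apply/metric_openP => x /= sg; exists ((2 * g j x - s x) / 3).
      by rewrite divr_gt0 // subr_gt0.
    move=> y xy; have := g_lip j x y; have := s_lip y x.
    rewrite (metric_sym y x) -/s -/(g j); lra.
  + by rewrite /= /s /g s_act g_act.
  + have s2 : s x / 2 < s x by have := s_gt0 x; lra.
    have s0 : 0 <= s x / 2 by have := s_gt0 x; lra.
    have [r [j [sr r1 rW]]] := leb_adherent s0 s2; exists j => /=.
    have : r <= g j x.
      apply: (leb_ub (i := tt)) => //; rewrite r1 andbT.
      by apply: le_trans s0 _; exact: ltW.
    lra.
- move=> j; apply/metric_closedP => x xr /=; rewrite leNgt; apply/negP => gs.
  have d0 : 0 < (s x - 2 * g j x) / 3 by rewrite divr_gt0 // subr_gt0.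
  have [y /= sy xy] := xr _ d0; have := g_lip j y x; have := s_lip x y.
  rewrite (metric_sym y x) -/s -/(g j); lra.
- by move=> j h x; rewrite /= /s /g s_act g_act.
- by move=> j x /=; exact: ltW.
- move=> j x /= sg; have : 0 < g j x by have := s_gt0 x; lra.
  by move=> /leb_gt0_mem[].
Qed.

(** The bound [n + 1] on the number of members that contain [x], in the form used for
    the covering dimension. *)
Definition order_le (n : nat) U x : Prop :=
  forall J : 'I_n.+2 -> nat, injective J -> ~ forall i, U (J i) x.

Lemma order_le_sub n U W x : (forall j, W j `<=` U j) ->
  order_le n U x -> order_le n W x.
Proof. by move=> WU Ux J Jinj WJ; apply: Ux Jinj _ => i; exact: WU. Qed.

(** The projection to the orbit space is injective on [E] and maps its closed subsets
    to closed sets. *)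
Definition section_set E : Prop :=
  (forall g x, E x -> E (act g x) -> act g x = x) /\
  forall D, D `<=` E -> closed D -> closed [set x | exists g y, D y /\ x = act g y].

(** One step of the countable sum theorem: a refinement on the whole space [X]
    can be transported to the orbit of a section and changes the given
    invariant cover there only. *)
Lemma section_refinement n U E : has_covering_bound X n -> closed E ->
  section_set E -> invariant_cover U ->
  exists W, [/\ invariant_cover W, forall j, W j `<=` U j &
    forall x, E x -> order_le n W x].
Proof.
move=> Xn Ecl [Einj Ecls] [Uo Uinv Uc].
have [V [[Vo Vc] Vref Vord]] : exists V : set (set X), [/\ open_covering V,
    refines V (range U) & forall B : 'I_n.+2 -> set X, injective B ->
      (forall i, V (B i)) -> \bigcap_i B i = set0].
  apply: Xn; split; first by move=> _ [j _ <-]; exact: Uo.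
  apply/seteqP; split=> // x _; have [j xj] := Uc x.
  by exists (U j) => //; exists j.
have [idx idxP] : exists idx : set X -> nat, forall B, V B -> B `<=` U (idx B).
  have ex B : exists j, V B -> B `<=` U j.
    have [/Vref[_ [j _ <-] BU]|nVB] := pselect (V B); first by exists j.
    by exists 0.
  by exists (fun B => sval (cid (ex B))) => B; case: cid.
pose V' j := \bigcup_(B in [set B | V B /\ idx B = j]) B.
have V'o j : open (V' j).
  by apply: bigcup_open => B [/Vo].
have V'U j : V' j `<=` U j by move=> x [B [VB <-] Bx]; exact: idxP Bx.
have V'c x : exists j, V' j x.
  have [B VB Bx] : (\bigcup_(A in V) A) x by rewrite Vc.
  by exists (idx B), B.
pose sat j := [set x | exists g y, (E `&` ~` V' j) y /\ x = act g y].
have sat_closed j : closed (sat j).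
  apply: Ecls; first by move=> x [].
  by apply: closedI => //; exact: open_closedC.
have sat_inv j g x : sat j (act g x) -> sat j x.
  move=> [h [y [yD gx]]]; exists (g^-1 * h)%g, y; split=> //.
  by rewrite actP.2 -gx actK.
have satE j x : E x -> sat j x -> ~ V' j x.
  by move=> Ex [g [y [[Ey nV] xE]]]; rewrite xE (Einj g y) // -xE.
exists (fun j => U j `&` ~` sat j); split.
- split=> [j|j g x [Ux nx]|x].
  + by apply: openI; [exact: Uo|exact: closed_openC].
  + by split; [exact: Uinv|move=> /sat_inv].
  + have [[g Eg]|nE] := pselect (exists g, E (act g x)).
      have [j jx] := V'c (act g x); exists j.
      split; first by rewrite -(actK g x); apply/Uinv/V'U.
      move=> xs; apply: (satE _ _ Eg _ jx); apply: (sat_inv _ g^-1%g).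
      by rewrite actK.
    have [j jx] := Uc x; exists j; split=> // -[g [y [[Ey _] xE]]].
    by apply: nE; exists g^-1%g; rewrite xE actK.
- by move=> j x [].
- move=> x Ex J Jinj JW.
  have V'x i : V' (J i) x.
    have [_ nx] := JW i; apply: contrapT => nV; apply: nx.
    by exists 1%g, x; rewrite actP.1.
  have [B BP] : exists B : 'I_n.+2 -> set X,
      forall i, [/\ V (B i), idx (B i) = J i & B i x].
    have ex i : exists B, [/\ V B, idx B = J i & B x].
      by have [B [VB iB] Bx] := V'x i; exists B.
    by exists (fun i => sval (cid (ex i))) => i; case: cid.
  have Binj : injective B.
    move=> i i' BB; apply: Jinj; have [_ <- _] := BP i; have [_ <- _] := BP i'.
    by rewrite BB.
  have : (\bigcap_i B i) x by move=> i _; have [] := BP i.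
  by rewrite Vord // => i; have [] := BP i.
Qed.

Definition locally_finite U : Prop := forall x, exists2 r : R, 0 < r &
  exists M, forall j, (M <= j)%N -> forall y, mdist x y < r -> ~ U j y.

(** A point stays in the [j]-th member only if the earlier members contain no ball of
    radius [1 / (j + 1)] around it. Around a point of [U j0] such balls exist, uniformly
    for large [j]. *)
Lemma invariant_locally_finite U : invariant_cover U -> exists W,
  [/\ invariant_cover W, forall j, W j `<=` U j & locally_finite W].
Proof.
move=> [Uo Uinv Uc].
pose g j := lebesgue_radius (single (U j)).
pose m j := lebesgue_radius (fun i : 'I_j => U i).
have g_act j := leb_single_act (Uinv j).
have m_act j h x : m j (act h x) = m j x.
  by apply: leb_act => k i; exists i => y; exact: Uinv.
exists (fun j => [set x | 0 < g j x /\ m j x < j.+1%:R^-1]); split.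
- split=> [j|j h x|x].
  + move: (j.+1%:R^-1) => q; apply/metric_openP => x [gx mx].
    exists (Num.min (g j x) (q - m j x)).
      by rewrite lt_min gx subr_gt0.
    move=> y; rewrite lt_min => /andP[xy xy'].
    have := leb_lip (single (U j)) x y; have := leb_lip (fun i : 'I_j => U i) y x.
    rewrite -/(m j) -/(g j) (metric_sym y x) => my gy.
    by split; [move: gy|move: my]; lra.
  + by rewrite /= /g g_act m_act.
  + have [j jx jmin] := ex_minnP (P := fun j => `[< U j x >])
      (let: ex_intro j jx := Uc x in ex_intro _ j (introT (asboolP _) jx)).
    exists j; split; first by apply: (leb_gt0 (i := tt)) (Uo j) _; exact/asboolP.
    rewrite (_ : m j x = 0) ?invr_gt0 ?ltr0n //; apply/eqP.
    rewrite eq_le leb_ge0 andbT leNgt; apply/negP => /leb_gt0_mem[i ix].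
    by have /jmin := introT (asboolP _) ix; rewrite leqNgt ltn_ord.
- by move=> j x [/leb_gt0_mem[]].
- move=> x; have [j0 j0x] := Uc x.
  have gx : 0 < g j0 x by exact: (leb_gt0 (U := single (U j0)) (i := tt) (Uo j0) j0x).
  exists (g j0 x / 2); first by rewrite divr_gt0.
  pose M := (Num.truncn (2 / g j0 x)).+1.
  exists (maxn M j0.+1) => j; rewrite geq_max => /andP[Mj j0j] y xy [_ my].
  have g_lip := leb_lip (single (U j0)) x y.
  have gm : g j0 y <= m j y.
    apply: ge_sup; first by exists 0; left.
    move=> r [->|[r01 [tt0 rU]]]; first exact: leb_ge0.
    exact: (leb_ub (i := Ordinal j0j)).
  have jM : j.+1%:R^-1 < g j0 x / 2.
    have MP : 2 / g j0 x < M%:R by exact: truncnS_gt.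
    rewrite -invf_div ltf_pV2 ?posrE ?ltr0n ?divr_gt0 //.
    by apply: lt_le_trans MP _; rewrite ler_nat leqW.
  move: g_lip my jM; rewrite -/(g j0); move: (j.+1%:R^-1) => q; lra.
Qed.

End InvariantCovers.

(** * The countable sum theorem for the orbit space *)

Section SumTheorem.
Variables (R : realType) (G : groupType) (X : metricType R) (act : G -> X -> X).
Hypothesis actP : action_law act.
Hypothesis act_iso : isometric_action act.
Implicit Types (x y z : X) (U W K : nat -> set X) (E : set X).
Local Notation act_stable := (act_stable act).
Local Notation invariant_cover := (invariant_cover act).
Local Notation section_set := (section_set act).

Lemma dense_sequence : separable_space X -> X ->
  exists q : nat -> X, forall x (r : R), 0 < r -> exists a, mdist x (q a) < r.
Proof.
move=> [D Dct Ddense] x0.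
have ballo x (r : R) : open (ball x r).
  apply/metric_openP => y; rewrite ballEmdist /= => xy.
  exists (r - mdist x y); first by rewrite subr_gt0.
  move=> z yz.
  by apply: le_lt_trans (metric_triangle _ y _) _; rewrite -ltrBrDl.
have Dball x (r : R) : 0 < r -> exists2 y, D y & mdist x y < r.
  move=> r0; have [|y [xy Dy]] := Ddense (ball x r) _ (ballo x r).
    by exists x; exact: ballxx.
  by exists y => //; move: xy => /=; rewrite ballEmdist.
have [y0 Dy0 _] := Dball x0 1 ltr01.
move: Dct => /pfcard_geP[D0|[q]]; first by rewrite D0 in Dy0.
exists q => x r /(Dball x)[y Dy xy].
by have [a _ qa] := 'surj_q Dy; exists a; rewrite qa.
Qed.

(** The gap between the radii [r] and [2 * r] makes the condition closed and lets only
    one translate of a point be near [q], also in the limit. *)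
Definition isolated_near (q : X) (r : R) : set X :=
  [set x | mdist q x <= r /\ forall g, act g x <> x -> 2 * r <= mdist q (act g x)].

Lemma isolated_near_closed q r : closed (isolated_near q r).
Proof.
apply/metric_closedP => x xcl; split.
  rewrite leNgt; apply/negP => rx.
  have d0 : 0 < mdist q x - r by rewrite subr_gt0.
  have [y [qy _] xy] := xcl _ d0.
  have := metric_triangle q y x; rewrite (metric_sym y x); lra.
move=> g gx; rewrite leNgt; apply/negP => rx.
have gx0 : 0 < mdist (act g x) x by rewrite mdist_gt0; apply/eqP.
have d0 : 0 < Num.min (mdist (act g x) x / 2) (2 * r - mdist q (act g x)).
  by rewrite lt_min divr_gt0 //= subr_gt0.
have [y [_ yfar]] := xcl _ d0; rewrite lt_min => /andP[xy xy'].
have gxy : mdist (act g x) (act g y) = mdist x y by exact: act_iso.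
have gy : act g y <> y.
  move=> gyy; have := metric_triangle (act g x) (act g y) x.
  by rewrite gxy gyy (metric_sym y x); lra.
have := yfar g gy; have := metric_triangle q (act g x) (act g y).
rewrite gxy; lra.
Qed.

Lemma isolated_near_section q r : 0 < r -> section_set (isolated_near q r).
Proof.
move=> r0; split=> [g x [_ xfar] [gx _]|D DE Dcl].
  by apply: contrapT => /xfar; lra.
apply/metric_closedP => y ycl.
have r4 : 0 < r / 4 by rewrite divr_gt0.
have [_ [g0 [x0 [Dx0 ->]]] yx0] := ycl _ r4.
(* Near [y] only the translate of [D] by [g0] matters. *)
exists g0, (act g0^-1%g y); rewrite actVK //; split=> //.
move/metric_closedP : Dcl; apply => e e0.
have e4 : 0 < Num.min e (r / 4) by rewrite lt_min e0.
have [_ [g [x [Dx ->]]]] := ycl _ e4; rewrite lt_min => /andP[ye yr].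
exists x => //.
pose h := (g0^-1 * g)%g.
have hE : act h x = act g0^-1%g (act g x) by rewrite actP.2.
have gy z : mdist (act g0^-1%g y) (act g0^-1%g z) = mdist y z by exact: act_iso.
have yh : mdist (act g0^-1%g y) (act h x) = mdist y (act g x) by rewrite hE gy.
have yx : mdist (act g0^-1%g y) x0 = mdist y (act g0 x0) by rewrite -(gy (act g0 x0)) actK.
have [qx xfar] := DE _ Dx; have [qx0 _] := DE _ Dx0.
have [<-|/eqP/xfar] := eqVneq (act h x) x; first by rewrite yh.
have := metric_triangle q x0 (act h x).
have := metric_triangle x0 (act g0^-1%g y) (act h x).
rewrite (metric_sym x0 (act g0^-1%g y)) yx yh; lra.
Qed.

Lemma discrete_isolated : discrete_action act -> forall x,
  exists2 e : R, 0 < e & forall g, mdist x (act g x) < e -> act g x = x.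
Proof.
move=> dis x.
have [|_ [V]] := dis x x; first by exists 1%g; rewrite ?actP.1.
rewrite -nbhs_ballE => -[e /= e0 eV] VE; exists e => // g xg.
have : (V `&` action_orbit act x) (act g x).
  by split; [apply: eV; rewrite ballEmdist|exists g].
by rewrite VE.
Qed.

(** The orbit space is a countable union of closed pieces that are embedded
    in [X]. *)
Lemma countable_sections : separable_space X -> discrete_action act -> X ->
  exists E : nat -> set X, [/\ forall i, closed (E i), forall i, section_set (E i) &
    forall x, exists i, E i x].
Proof.
move=> Xsep Xdis x0; have [q qP] := dense_sequence Xsep x0.
pose E i := if unpickle i is Some (a, m)
  then isolated_near (q a) (m.+1%:R^-1 : R) else set0 : set X.
exists E; split=> [i|i|x].
- rewrite /E; case: unpickle => [[a m]|]; last exact: closed0.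
  exact: isolated_near_closed.
- rewrite /E; case: unpickle => [[a m]|]; last first.
    split=> // D; rewrite subset0 => -> _.
    have -> : [set x | exists g y, set0 y /\ x = act g y] = set0.
      by apply/seteqP; split=> x // -[g [y []]].
    exact: closed0.
  by apply: isolated_near_section; rewrite invr_gt0 ltr0n.
- have [e e0 eP] := discrete_isolated Xdis x.
  pose m := Num.truncn (3 / e).
  have me : m.+1%:R^-1 <= e / 3.
    rewrite -invf_div lef_pV2 ?posrE ?ltr0n ?divr_gt0 //.
    by apply: ltW; exact: truncnS_gt.
  have m0 : 0 < m.+1%:R^-1 :> R by rewrite invr_gt0 ltr0n.
  have [a xa] := qP x _ m0; exists (pickle (a, m)).
  rewrite /E pickleK; move: me m0 xa; move: (m.+1%:R^-1) => r re r0 xa.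
  split; first by rewrite metric_sym ltW.
  move=> g gx; rewrite leNgt; apply/negP => qg; apply: gx; apply: eP.
  have := metric_triangle x (q a) (act g x); lra.
Qed.

(** Countable sum theorem for the orbit space: an invariant cover is refined on
    the orbits of one section after the other, and the limit of the closed
    shrinkings, which is a locally finite closed cover, is swollen to an open cover. *)
Lemma order_refinement n U : has_covering_bound X n ->
  (exists E : nat -> set X, [/\ forall i, closed (E i), forall i, section_set (E i) &
    forall x, exists i, E i x]) ->
  invariant_cover U -> exists W, [/\ invariant_cover W, forall j, W j `<=` U j &
    forall x, order_le n W x].
Proof.
move=> Xn [E [Ecl Esec Ec]] /(invariant_locally_finite actP act_iso).
move=> [U0 [U0c U0U U0fin]].
have step i W : invariant_cover W -> exists WK : (nat -> set X) * (nat -> set X),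
    [/\ invariant_cover WK.1,
        [/\ forall j, closed (WK.2 j), forall j, act_stable (WK.2 j),
          forall j, WK.1 j `<=` WK.2 j & forall j, WK.2 j `<=` W j] &
        forall x, E i x -> order_le n WK.2 x].
  move=> Wc; have [V [Vc VW Vord]] := section_refinement actP Xn (Ecl i) (Esec i) Wc.
  have [W' [K [W'c Kcl Kinv W'K KV]]] := invariant_shrinking actP act_iso Vc.
  exists (W', K); split=> //.
    by split=> // j; apply: subset_trans (KV j) (VW j).
  by move=> x /Vord; exact: order_le_sub.
pose cover := {W : nat -> set X | invariant_cover W}.
pose next i (W : cover) := cid (step i (sval W) (svalP W)).
have nextP i (W : cover) : invariant_cover (sval (next i W)).1.
  by case: (svalP (next i W)).
pose seqW := fix seqW i : cover :=
  if i is i'.+1 then exist _ _ (nextP i' (seqW i')) else exist _ U0 U0c.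
pose Ws i := sval (seqW i); pose Ks i := (sval (next i (seqW i))).2.
have WsP i : [/\ forall j, closed (Ks i j), forall j, act_stable (Ks i j),
    forall j, Ws i.+1 j `<=` Ks i j & forall j, Ks i j `<=` Ws i j].
  by case: (svalP (next i (seqW i))).
have Ks_ord i x : E i x -> order_le n (Ks i) x.
  by case: (svalP (next i (seqW i))) => _ _; apply.
have Ws_dec i i' j : (i <= i')%N -> Ws i' j `<=` Ws i j.
  move=> /subnK <-; elim: (i' - i)%N => [//|k IHk].
  have [_ _ WK KW] := WsP (k + i)%N.
  by apply: subset_trans IHk; apply: subset_trans (WK j) (KW j).
pose K j := \bigcap_(i in [set: nat]) Ks i j.
have Kcl j : closed (K j) by apply: closed_bigI => i _; have [] := WsP i.
have Kinv j : act_stable (K j).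
  by move=> g x Kx i _; have [_ + _ _] := WsP i; apply; exact: Kx.
have KU0 j : K j `<=` U0 j.
  by move=> x /(_ 0 I); have [_ _ _] := WsP 0; apply.
have K_ord x : order_le n K x.
  have [i Ex] := Ec x; apply: order_le_sub (Ks_ord i x Ex).
  by move=> j y; apply.
have Kc x : exists j, K j x.
  have [r r0 [M UM]] := U0fin x.
  apply: contrapT => nK.
  have bad j : exists i, ~ Ws i j x.
    apply: contrapT => allW; apply: nK; exists j => i _.
    have [_ _ + _] := WsP i; apply; apply: contrapT => nW.
    by apply: allW; exists i.+1.
  pose b j := sval (cid (bad j)).
  have bP j : ~ Ws (b j) j x by rewrite /b; case: cid.
  pose i := \max_(j < M) b j.
  have [_ _ Wc] := svalP (seqW i); have [j jx] := Wc x.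
  have jM : (j < M)%N.
    rewrite ltnNge; apply/negP => Mj; apply: (UM j Mj x); first by rewrite mdistxx.
    exact: (Ws_dec 0 i j (leq0n _)).
  apply: (bP j); apply: (Ws_dec _ i) jx.
  exact: (leq_bigmax (F := fun j : 'I_M => b j) (Ordinal jM)).
have Kfin x : exists2 r : R, 0 < r &
    forall j y, K j y -> mdist x y < r -> K j x.
  have [r r0 [M UM]] := U0fin x.
  suff [r' [r'0 r'r r'P]] : exists r' : R, [/\ 0 < r', r' <= r &
      forall j, (j < M)%N -> forall y, K j y -> mdist x y < r' -> K j x].
    exists r' => // j y Ky xy; have [jM|Mj] := ltnP j M; first exact: r'P jM y Ky xy.
    by case: (UM j Mj y (lt_le_trans xy r'r)); exact: KU0.
  elim: (M) => [|M' [r' [r'0 r'r r'P]]]; first by exists r.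
  have [Kx|nKx] := pselect (K M' x).
    exists r'; split=> // j; rewrite ltnS leq_eqVlt => /predU1P[->//|].
    exact: r'P.
  have [s s0 sP] : exists2 s : R, 0 < s & forall y, mdist x y < s -> ~ K M' y.
    by move/closed_openC : (Kcl M') => /metric_openP/(_ _ nKx).
  exists (Num.min r' s); split; first by rewrite lt_min r'0.
    by rewrite ge_min r'r.
  move=> j; rewrite ltnS leq_eqVlt => /predU1P[->|jM] y Ky; rewrite lt_min => /andP[xr xs].
    by case: (sP y xs).
  exact: r'P jM y Ky xr.
pose W j := [set y | U0 j y /\ exists x (r : R), [/\ K j x, 0 < r,
  forall k z, K k z -> mdist x z < r -> K k x & mdist x y < r / 2]].
have [U0o U0inv _] := U0c.
exists W; split.
- split=> [j|j g y [Uy [x [r [Kx r0 rP xy]]]]|x].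
  + apply/metric_openP => y [Uy [x [r [Kx r0 rP xy]]]].
    have /metric_openP/(_ _ Uy)[s s0 sU] := U0o j.
    exists (Num.min s (r / 2 - mdist x y)); first by rewrite lt_min s0 subr_gt0.
    move=> z; rewrite lt_min => /andP[yz yz']; split; first exact: sU.
    exists x, r; split=> //; have := metric_triangle x y z; lra.
  + split; first exact: U0inv.
    exists (act g x), r; rewrite act_iso; split=> //; first exact: Kinv.
    move=> k z Kz; rewrite (mdist_actl actP act_iso) => xz.
    apply: (Kinv k); apply: rP xz; exact: Kinv.
  + have [j Kx] := Kc x; exists j; split; first exact: KU0.
    have [r r0 rP] := Kfin x; exists x, r.
    by split=> //; rewrite mdistxx divr_gt0.
- by move=> j y [/U0U].
- move=> y J Jinj JW.
  have [c cP] : exists c : 'I_n.+2 -> X * R, forall i, [/\ K (J i) (c i).1,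
      0 < (c i).2, forall k z, K k z -> mdist (c i).1 z < (c i).2 -> K k (c i).1 &
      mdist (c i).1 y < (c i).2 / 2].
    have ex i : exists c : X * R, [/\ K (J i) c.1,
      0 < c.2, forall k z, K k z -> mdist c.1 z < c.2 -> K k c.1 &
      mdist c.1 y < c.2 / 2].
      by have [_ [x [r xr]]] := JW i; exists (x, r).
    by exists (fun i => sval (cid (ex i))) => i; case: cid.
  pose i0 := [arg max_(i > ord0) (c i).2]%O.
  have i0P i : (c i).2 <= (c i0).2.
    by rewrite /i0; case: Order.TotalTheory.arg_maxP => // k _; apply.
  apply: (K_ord (c i0).1 J Jinj) => i.
  have [Ki _ _ yi] := cP i; have [_ _ near0 y0] := cP i0.
  apply: near0 Ki _; have := metric_triangle (c i0).1 y (c i).1.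
  have := i0P i; rewrite (metric_sym y); lra.
Qed.

(** The cover by orbits of isolating balls has a countable subcover, since there are
    countably many balls with centre in a dense sequence and radius [1 / (m + 1)], and
    for each of them one isolating ball that contains it suffices. *)
Lemma slice_cover n : separable_space X -> discrete_action act ->
  has_covering_bound X n -> X ->
  exists (c : nat -> X) (e : nat -> R) (W : nat -> set X),
    [/\ forall j, 0 < e j,
        forall j g, mdist (c j) (act g (c j)) < e j -> act g (c j) = c j,
        invariant_cover W,
        forall j x, W j x -> exists g, mdist (act g (c j)) x < e j / 4 &
        forall x, order_le n W x].
Proof.
move=> Xsep Xdis Xn x0; have [q qP] := dense_sequence Xsep x0.
have [e eP] : exists e : X -> R, forall x,
    0 < e x /\ forall g, mdist x (act g x) < e x -> act g x = x.
  have ex x : exists e : R, 0 < e /\ forall g, mdist x (act g x) < e -> act g x = x.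
    by have [e e0 eP] := discrete_isolated Xdis x; exists e.
  by exists (fun x => sval (cid (ex x))) => x; case: cid.
pose good a m x := mdist (q a) x < m.+1%:R^-1 /\ 2 * m.+1%:R^-1 <= e x / 4.
pose c j := if unpickle j is Some (a, m) then xget x0 (good a m) else x0.
pose O j := [set x | exists g, mdist (act g (c j)) x < e (c j) / 4].
have Oc : invariant_cover O.
  split=> [j|j h x [g gx]|x].
  - apply/metric_openP => x [g gx]; exists (e (c j) / 4 - mdist (act g (c j)) x).
      by rewrite subr_gt0.
    move=> y xy; exists g; have := metric_triangle (act g (c j)) x y; lra.
  - by exists (h * g)%g; rewrite actP.2 act_iso.
  - have [ex0 _] := eP x; pose m := Num.truncn (8 / e x).
    have me : m.+1%:R^-1 <= e x / 8.
      rewrite -invf_div lef_pV2 ?posrE ?ltr0n ?divr_gt0 //.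
      by apply: ltW; exact: truncnS_gt.
    have m0 : 0 < m.+1%:R^-1 :> R by rewrite invr_gt0 ltr0n.
    have [a xa] := qP x _ m0; exists (pickle (a, m)), 1%g.
    rewrite actP.1 /c pickleK.
    have gx : good a m x.
      split; first by rewrite metric_sym.
      by move: me; move: (m.+1%:R^-1) => r; lra.
    have [qc ce] := xgetPex x0 (ex_intro (good a m) x gx).
    move: qc ce; move: (xget _ _) => y; move: xa; move: (m.+1%:R^-1) => r xa qy re.
    have := metric_triangle y (q a) x; rewrite (metric_sym y (q a)) (metric_sym (q a) x); lra.
have [W [Wc WO Word]] := order_refinement Xn (countable_sections Xsep Xdis x0) Oc.
exists c, (e \o c), W; split=> //.
- by move=> j; case: (eP (c j)).
- by move=> j; case: (eP (c j)).
Qed.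

End SumTheorem.

(** * The nerve of a cover by slices *)

Section StabilizerFamily.
Variables (G : groupType) (T : Type) (act : G -> T -> T).
Hypothesis actP : action_law act.
Local Notation F := (smallest (@is_family G) (range (stabilizer act))).

Lemma is_subgroup_conj (H : set G) (g : G) :
  is_subgroup H -> is_subgroup [set (g * h * g^-1)%g | h in H].
Proof.
move=> [H1 HM HV]; split.
- by exists 1%g; rewrite // mulg1 mulgV.
- move=> _ _ [h Hh <-] [k Hk <-]; exists (h * k)%g; first exact: HM.
  by rewrite !mulgA mulgVK.
- move=> _ [h Hh <-]; exists h^-1%g; first exact: HV.
  by rewrite !invgM invgK mulgA.
Qed.

(** As a family that contains the stabilizers, it contains the smallest such family,
    whose members therefore fix points. *)
Definition fixing_family : set (set G) :=
  [set H | is_subgroup H /\ exists x, forall h, H h -> act h x = x].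

Lemma fixing_familyP : is_family fixing_family.
Proof.
split=> [H []//|H g [Hs [x Hx]]|H K [_ [x Hx]] Ks KH].
  split; first exact: is_subgroup_conj.
  exists (act g x) => _ [h Hh <-].
  by rewrite !actP.2 -(actP.2 g^-1%g) mulVg actP.1 Hx.
by split=> //; exists x => k /KH /Hx.
Qed.

Lemma stabilizers_fixing : range (stabilizer act) `<=` fixing_family.
Proof.
by move=> _ [x _ <-]; split; [exact: stabilizer_subgroup|exists x].
Qed.

Lemma stabilizer_family : is_family F.
Proof.
split=> [H|H g FH|H K FH Ks KH].
- move=> /(_ _ (conj fixing_familyP stabilizers_fixing)); by case.
- by move=> C [Cf Cs]; have [_ + _] := Cf; apply; exact: FH.
- by move=> C [Cf Cs]; have [_ _] := Cf; apply; [exact: FH| |exact: KH].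
Qed.

Lemma stabilizer_in_family x : F (stabilizer act x).
Proof. by move=> C [_ Cs]; apply: Cs; exists x. Qed.

Lemma family_fixed_point H : F H -> exists x, forall h, H h -> act h x = x.
Proof. by move=> /(_ _ (conj fixing_familyP stabilizers_fixing)) []. Qed.

End StabilizerFamily.

(** The case of an empty space: the orbit category has no objects, so that all
    modules are zero. *)
Lemma bredon_cohomology_no_orbit (G : groupType) (F : set (set G)) k (M : orbit_module F)
    (h : bredon_cohomology k M) : (forall H, ~ F H) -> h = 0.
Proof.
move=> nF; have homE (P N : orbit_module F) (u v : om_hom P N) : u = v.
  by apply: om_hom_eq => -[H FH]; case: (nF H).
by case: k h => [|k] h; apply: homology_eq0 h => y _; exists 0; exact: homE.
Qed.

Section Assembly.
Variables (R : realType) (G : groupType) (X : metricType R) (act : G -> X -> X).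
Variable n : nat.
Hypothesis actP : action_law act.
Hypothesis act_iso : isometric_action act.
Hypothesis CX : CAT0 X.
Local Notation F := (smallest (@is_family G) (range (stabilizer act))).
Variables (x0 : X) (c : nat -> X) (e : nat -> R) (W : nat -> set X).
Hypothesis e_gt0 : forall j, 0 < e j.
Hypothesis c_isolated : forall j g,
  mdist (c j) (act g (c j)) < e j -> act g (c j) = c j.
Hypothesis W_cover : invariant_cover act W.
Hypothesis W_near : forall j x, W j x -> exists g, mdist (act g (c j)) x < e j / 4.
Hypothesis W_order : forall x, order_le n W x.

(** A vertex of the nerve is a slice of a member [W j] of the cover, named by the
    translate of [c j] that it surrounds. *)
Definition vertex : choiceType := (nat * X)%type.

Definition vertex_act (g : G) (v : vertex) : vertex := (v.1, act g v.2).

Lemma vertex_actP : action_law vertex_act.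
Proof.
by split=> [[j x]|g h [j x]]; rewrite /vertex_act /= ?actP.1 ?actP.2.
Qed.

Definition slice (v : vertex) : set X := [set x | [/\ W v.1 x,
  exists g, v.2 = act g (c v.1) & mdist v.2 x < e v.1 / 4]].

(** Distinct translates of [c j] are at distance at least [e j]. *)
Lemma slice_unique j y y' x : slice (j, y) x -> slice (j, y') x -> y = y'.
Proof.
move=> [/= _ [g ->] gx] [/= _ [h ->] hx].
have gh : act (g^-1 * h)%g (c j) = c j.
  apply: c_isolated; rewrite actP.2 -mdist_actl //.
  have := metric_triangle (act g (c j)) x (act h (c j)).
  rewrite (metric_sym x); have := e_gt0 j; lra.
by rewrite -{1}gh -actP.2 mulgA mulgV mul1g.
Qed.

Lemma slice_act g v x : slice v x -> slice (vertex_act g v) (act g x).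
Proof.
move=> [Wx [h vh] vx]; split=> /=; first exact: (ic_inv W_cover).
  by exists (g * h)%g; rewrite vh actP.2.
by rewrite act_iso.
Qed.

Let r : X -> R := lebesgue_radius slice.

Let r_act g x : r (act g x) = r x.
Proof.
apply: leb_act => // h v; exists (vertex_act h v) => y.
exact: slice_act.
Qed.

Let r_lip x y : r x <= r y + mdist x y.
Proof. exact: leb_lip. Qed.

Let r_gt0 x : 0 < r x.
Proof.
have [j Wx] := ic_cover W_cover x; have [g gx] := W_near Wx.
apply: (leb_gt0 (i := (j, act g (c j)))); last first.
  by split=> //; exists g.
apply/metric_openP => y [/= Wy gP gy].
have /metric_openP/(_ _ Wy)[s s0 sW] := ic_open W_cover j.
exists (Num.min s (e j / 4 - mdist (act g (c j)) y)).
  by rewrite lt_min s0 subr_gt0.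
move=> z; rewrite lt_min => /andP[yz yz']; split=> //=; first exact: sW.
have := metric_triangle (act g (c j)) y z; lra.
Qed.

Let holds_ball (v : vertex) x := forall z, mdist x z < r x / 2 -> slice v z.

Let holds_ball_act g v x : holds_ball v x -> holds_ball (vertex_act g v) (act g x).
Proof.
move=> vx z; rewrite r_act mdist_actl // => /vx /(slice_act g).
by rewrite actVK.
Qed.

Let holds_ball_self v x : holds_ball v x -> slice v x.
Proof. by apply; rewrite mdistxx divr_gt0. Qed.

(** The first index is chosen so that the map to the nerve is equivariant. *)
Lemma nerve_vertex_exists : exists phi : X -> vertex, forall x,
  holds_ball (phi x) x /\ forall v, holds_ball v x -> ((phi x).1 <= v.1)%N.
Proof.
have ex x : exists v : vertex, holds_ball v x /\
    forall w, holds_ball w x -> (v.1 <= w.1)%N.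
  have jE : exists j : nat, `[< exists y, holds_ball (j, y) x >].
    have r0 : 0 <= r x / 2 by rewrite divr_ge0 // ltW.
    have r2 : r x / 2 < r x by have := r_gt0 x; lra.
    have [s [[j y] [sr _ sU]]] := leb_adherent r0 r2.
    exists j; apply/asboolP; exists y => z xz; apply: sU; exact: lt_trans sr.
  have [i /asboolP[y iy] imin] := ex_minnP jE.
  exists (i, y); split=> // -[i' y'] iy' /=; apply: imin; apply/asboolP.
  by exists y'.
by exists (fun x => sval (cid (ex x))) => x; case: cid.
Qed.

Let phi : X -> vertex := sval (cid nerve_vertex_exists).

Let phiP x :
  holds_ball (phi x) x /\ forall v, holds_ball v x -> ((phi x).1 <= v.1)%N.
Proof. by rewrite /phi; case: cid. Qed.

Let phi_act g x : phi (act g x) = vertex_act g (phi x).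
Proof.
have [gx gmin] := phiP (act g x); have [xx xmin] := phiP x.
have idx : (phi (act g x)).1 = (phi x).1.
  apply/eqP; rewrite eqn_leq; apply/andP; split.
    by have := gmin _ (holds_ball_act (g:=g) xx).
  by have := holds_ball_act (g:=g^-1%g) gx; rewrite actK // => /xmin.
move: gx (holds_ball_act (g:=g) xx) => /holds_ball_self + /holds_ball_self.
rewrite /vertex_act; case: (phi (act g x)) idx => j y /= ->.
by move=> yx yx'; congr pair; exact: slice_unique yx yx'.
Qed.

Let N : set (seq vertex) := [set s : seq vertex | exists q, forall v, v \in s -> slice v q].

(** If [x] is in the ball of this radius around [q], then [q] is in the ball of radius
    [r x / 2] around [x], because [r] is 1-Lipschitz. *)
Let radius x : R := r x / 8.

Let small_tuples := small radius.

Let radius_gt0 x : 0 < radius x.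
Proof. by rewrite divr_gt0. Qed.

Let radius_lip x y : radius x <= radius y + mdist x y.
Proof. by have := r_lip x y; have := mdist_ge0 x y; rewrite /radius; lra. Qed.

Let small_fill H k z : F H ->
  supported (fixpts (tuple_act act) (tuples small_tuples k) H) z -> bd z = 0 ->
  exists2 w, supported (fixpts (tuple_act act) (tuples small_tuples k.+1) H) w & bd w = z.
Proof.
move=> /(family_fixed_point actP)[p pH] zP z0.
pose B := [set x | forall h, H h -> act h x = x].
have Bconv : geodesically_convex CX B.
  move=> x y t xH yH t01 h Hh.
  rewrite (isometry_geopt CX (f := act h)) ?xH ?yH //; exact: act_iso.
have [|w wP wz] := small_acyclic radius_gt0 radius_lip Bconv pH _ z0 (k := k).
  apply: sub_supp zP => s [[sS sk] sH]; split; first by split.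
  by move=> x xs h Hh; have /tuple_fixP := sH h Hh; apply.
exists w => //; apply: sub_supp wP => s [[sk sS] sB]; split; first by split.
by move=> h Hh; apply/tuple_fixP => x xs; exact: sB.
Qed.

Lemma slice_cover_Ext_eq0 k M (h : Ext k (constZ F) M) : (n < k)%N -> h = 0.
Proof.
apply: (@nerve_Ext_eq0 G F (stabilizer_family actP) X vertex act vertex_act actP
  vertex_actP small_tuples N fst phi n).
- move=> g s [q qs]; exists (act g q) => _ /mapP[x xs ->].
  by rewrite act_iso /radius r_act; exact: qs.
- by move=> s t [q qs] ts; exists q => x /(mem_subseq ts) /qs.
- by exists x0.
- exact: small_fill.
- move=> g s [q qs]; exists (act g q) => _ /mapP[v vs ->].
  by apply: slice_act; exact: qs.
- by move=> s t [q qs] ts; exists q => v /ts /qs.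
- move=> s [q qs] [j y] [j' y'] ys ys' /= jj; rewrite -jj in ys' *.
  by congr pair; exact: slice_unique (qs _ ys) (qs _ ys').
- move=> s [q qs] us; rewrite leqNgt; apply/negP => ns.
  have lt_s (i : 'I_n.+2) : (i < size s)%N by exact: leq_trans (ltn_ord i) ns.
  apply: (W_order (x := q) (J := fun i => (nth (0%N, x0) s i).1)) => [i i' /= ii|i].
    apply: val_inj; apply/eqP; rewrite -(nth_uniq (0%N, x0) (lt_s i) (lt_s i') us).
    have := qs _ (mem_nth (0%N, x0) (lt_s i)); have := qs _ (mem_nth (0%N, x0) (lt_s i')).
    case: (nth _ s i) ii => j y /= ->; case: (nth _ s i') => j' y' /= yq' yq.
    by rewrite (slice_unique yq yq').
  by have [] := qs _ (mem_nth (0%N, x0) (lt_s i)).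
- move=> s [j y] _ _; have -> : stabilizer vertex_act (j, y) = stabilizer act y.
    apply/seteqP; split=> g; rewrite /stabilizer /vertex_act /=; last by move=> ->.
    by move=> [].
  exact: stabilizer_in_family.
- by [].
- exact: phi_act.
- move=> s [q qs]; exists q => _ /mapP[x xs ->].
  have [+ _] := phiP x; apply.
  have := qs _ xs; have := r_lip q x; have := r_gt0 q.
  rewrite /radius (metric_sym x q); lra.
Qed.

End Assembly.

(** A finite infimum of natural numbers is attained. *)
Lemma covering_dimension_bound (R : realType) (T : topologicalType) (n : nat) :
  covering_dimension R T = (n%:R%R)%:E -> has_covering_bound T n.
Proof.
move=> dimT.
have lt_n : (covering_dimension R T < (n.+1%:R)%:E)%E by rewrite dimT lte_fin ltr_nat.
have [_ [d dT <-] dn] := ereal_inf_lt lt_n.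
have : (covering_dimension R T <= (d%:R)%:E)%E by apply: ereal_inf_lbound; exists d.
rewrite dimT lee_fin ler_nat => nd; move: dn; rewrite lte_fin ltr_nat ltnS => dn.
by have -> : n = d by apply/eqP; rewrite eqn_leq nd.
Qed.

Theorem corollary1 (R : realType) (G : groupType) (X : metricType R)
    (act : G -> X -> X) (n : nat) :
  action_law act -> isometric_action act -> discrete_action act ->
  CAT0 X -> separable_space X -> covering_dimension R X = (n%:R%R)%:E ->
  (cd (smallest (@is_family G) (range (stabilizer act))) R <= (n%:R%R)%:E)%E.
Proof.
move=> actP act_iso Xdis CX Xsep /covering_dimension_bound Xn.
apply: ge_ereal_sup => _ [k [M [h h0]] <-]; rewrite lee_fin ler_nat leqNgt.
apply/negP => nk; move/eqP: h0; apply.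
have [[x0 _]|nX] := pselect (exists x : X, True).
  have [c [e [W [e0 cP Wc Wn Word]]]] := slice_cover actP act_iso Xsep Xdis Xn x0.
  exact: (slice_cover_Ext_eq0 actP act_iso CX x0 e0 cP Wc Wn Word).
by apply: bredon_cohomology_no_orbit => H /(family_fixed_point actP)[x _]; apply: nX; exists x.
Qed.
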